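(* As $n\to\infty$, $$\mathcal{M}_1(B_2^n)=\mathcal{M}_1(q_2)\,e^{o(n)}=(4\pi)^n\,e^{o(n)},\qquad\text{where } q_2(x)=|x|^2/2,\ x\in\mathbb{R}^n,$$ and $$\int_0^\infty\frac{r^{\frac{3n}{2}-1}}{I_{n/2}(r)}\,dr=\left(\frac{2n^{3/2}}{e^{3/2}}\right)^n e^{o(n)}.$$
   Context: $B_2^n=\{x\in\mathbb{R}^n:|x|\le1\}$ is the Euclidean unit ball. For a convex body $K\subset\mathbb{R}^n$ with volume $|K|$, $h_{1,K}(y)=\log\int_Ke^{\langle x,y\rangle}\frac{dx}{|K|}$ and the $L^1$-Mahler volume is $\mathcal{M}_1(K)=|K|\int_{\mathbb{R}^n}e^{-h_{1,K}(y)}\,dy$. For a function $f:\mathbb{R}^n\to\mathbb{R}\cup\{\infty\}$ with $V(f)=\int_{\mathbb{R}^n}e^{-f(x)}dx\in(0,\infty)$, $f^{*,1}(y)=\log\int_{\mathbb{R}^n}e^{\langle x,y\rangle-2f(x)}\frac{dx}{V(f)}$ and $\mathcal{M}_1(f)=V(f)\int_{\mathbb{R}^n}e^{-f^{*,1}(y)}\,dy$. $I_\alpha(x)=\sum_{m=0}^\infty\left(\frac x2\right)^{2m+\alpha}\frac{1}{m!\,\Gamma(m+\alpha+1)}$ is the modified Bessel function of the first kind. $e^{o(n)}$ denotes a positive quantity $c_n$ with $\frac1n\log c_n\to0$ as $n\to\infty$. *)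

(* Defs.v *)
From HB Require Import structures.
From mathcomp Require Import all_boot all_order all_algebra.
From mathcomp Require Import all_classical all_reals all_analysis.
Set Implicit Arguments.
Unset Strict Implicit.
Unset Printing Implicit Defensive.
Import Order.TTheory GRing.Theory Num.Theory.
Import numFieldTopology.Exports numFieldNormedType.Exports.
Local Open Scope classical_set_scope.
Local Open Scope ring_scope.

(* R^n is n.-tuple R with its product sigma-algebra (generated by the
   coordinates).  Lebesgue measure on R^n is obtained by transporting the
   product measure along R x R^n -> R^n.+1, starting from the Dirac mass on the
   one-point space R^0; lebesgue_tuple_box checks the value on boxes. *)

Section LebesgueTuple.
Variable R : realType.

Definition tuple_of_pair (n : nat) (p : R * n.-tuple R) : n.+1.-tuple R :=
  [tuple of p.1 :: p.2].

Lemma measurable_tuple_of_pair n :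
  measurable_fun [set: R * n.-tuple R] (@tuple_of_pair n).
Proof. exact: measurable_cons. Qed.

Definition pair_of_tuple (n : nat) (t : n.+1.-tuple R) : R * n.-tuple R :=
  (thead t, [tuple of behead t]).

Lemma measurable_pair_of_tuple n :
  measurable_fun [set: n.+1.-tuple R] (@pair_of_tuple n).
Proof.
by apply/measurable_fun_pairP; split;
  [exact: measurable_tnth|exact: measurable_behead].
Qed.

Lemma tuple_of_pairK n : cancel (@tuple_of_pair n) (@pair_of_tuple n).
Proof.
by case=> x t; rewrite /pair_of_tuple theadE; congr pair; exact: val_inj.
Qed.

Lemma pair_of_tupleK n : cancel (@pair_of_tuple n) (@tuple_of_pair n).
Proof. by move=> t; rewrite [RHS]tuple_eta; exact: val_inj. Qed.

Section Succ.
Variable n : nat.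
Variable mu : {sigma_finite_measure set (n.-tuple R) -> \bar R}.

Let lam : {sigma_finite_measure set (measurableTypeR R) -> \bar R} :=
  @lebesgue_measure R.

Definition cons_measure : set (n.+1.-tuple R) -> \bar R :=
  pushforward (lam \x mu)%E (@tuple_of_pair n).

Let cons_measure0 : cons_measure set0 = 0%E.
Proof. by rewrite /cons_measure /pushforward preimage_set0 measure0. Qed.

Let cons_measure_ge0 A : (0 <= cons_measure A)%E.
Proof. exact: (measure_ge0 (lam \x mu)%E). Qed.

Let cons_measure_sigma_additive : semi_sigma_additive cons_measure.
Proof.
have mf := @measurable_tuple_of_pair n.
move=> F mF tF mUF; rewrite /cons_measure /pushforward preimage_bigcup.
apply: (@measure_semi_sigma_additive _ _ _ (lam \x mu)%E).
- by move=> k; rewrite -[X in measurable X]setTI; exact: mf.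
- apply/trivIsetP => /= i j _ _ ij; rewrite -preimage_setI.
  by move/trivIsetP : tF => /(_ _ _ _ _ ij) ->//; rewrite preimage_set0.
- by rewrite -preimage_bigcup -[X in measurable X]setTI; exact: mf.
Qed.

HB.instance Definition _ := isMeasure.Build _ _ _ cons_measure
  cons_measure0 cons_measure_ge0 cons_measure_sigma_additive.

Let cons_measure_sigma_finite : sigma_finite setT cons_measure.
Proof.
have /sigma_finiteP[F [TF ndF Foo]] := sigma_finiteT lam.
have /sigma_finiteP[G [TG ndG Goo]] := sigma_finiteT mu.
exists (fun k => @pair_of_tuple n @^-1` (F k `*` G k)).
  rewrite -preimage_bigcup (_ : \bigcup_k _ = setT) ?preimage_setT//.
  apply/seteqP; split=> // -[x t] _.
  have [i _ Fx] : (\bigcup_k F k) x by rewrite -TF.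
  have [j _ Gt] : (\bigcup_k G k) t by rewrite -TG.
  exists (maxn i j) => //; split.
    by move: x Fx; exact/subsetPset/ndF/leq_maxl.
  by move: t Gt; exact/subsetPset/ndG/leq_maxr.
move=> k; have [mF Fk] := Foo k; have [mG Gk] := Goo k.
have mFG : measurable (F k `*` G k) by exact: measurableX.
split; first by rewrite -[X in measurable X]setTI; exact: measurable_pair_of_tuple.
rewrite /cons_measure /pushforward -comp_preimage.
rewrite (_ : _ \o _ = id) ?preimage_id; last first.
  by apply/funext => p /=; rewrite tuple_of_pairK.
by rewrite product_measure1E// lte_mul_pinfty// ge0_fin_numE.
Qed.

HB.instance Definition _ := Measure_isSigmaFinite.Build _ _ _ cons_measure
  cons_measure_sigma_finite.

End Succ.

Fixpoint lebesgue_tuple (n : nat) :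
    {sigma_finite_measure set (n.-tuple R) -> \bar R} :=
  match n with
  | 0 => dirac [tuple]
  | m.+1 => cons_measure (lebesgue_tuple m)
  end.

Lemma lebesgue_tuple_box (n : nat) (A : 'I_n -> set R) :
  (forall i, measurable (A i)) ->
  lebesgue_tuple n [set t | forall i, A i (tnth t i)] =
  (\prod_(i < n) lebesgue_measure (A i))%E.
Proof.
elim: n A => [|n IHn] A mA.
  by rewrite big_ord0 /= diracE mem_set// => -[].
have mB : measurable [set t : n.-tuple R | forall i, A (lift ord0 i) (tnth t i)].
  rewrite (_ : [set t | _] =
    \bigcap_(i in [set: 'I_n]) (@tnth n R ^~ i @^-1` A (lift ord0 i))).
    apply: fin_bigcap_measurable => // i _; rewrite -[X in measurable X]setTI.
    exact: measurable_tnth.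
  by apply/seteqP; split=> [t At i _|t At i]; exact: At.
have E : @tuple_of_pair n @^-1` [set t | forall i, A i (tnth t i)] =
    A ord0 `*` [set t | forall i, A (lift ord0 i) (tnth t i)].
  apply/seteqP; split=> [[x t] /= At|[x t] /= [Ax At] i].
    split; first exact: (At ord0).
    by move=> i; have := At (lift ord0 i); rewrite tnthS.
  by case: (unliftP ord0 i) => [j ->|->//]; rewrite tnthS; exact: At.
rewrite big_ord_recl -(IHn (fun i => A (lift ord0 i)))//.
rewrite -(@product_measure1E _ _ _ _ _ (@lebesgue_measure R)
  (lebesgue_tuple n) _ _ (mA ord0) mB) -E.
by [].
Qed.

End LebesgueTuple.

Section Mahler.
Variables (R : realType) (n : nat).
Local Notation leb := (lebesgue_tuple R n).

Definition dot (x y : n.-tuple R) : R := \sum_(i < n) tnth x i * tnth y i.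

Definition enorm (x : n.-tuple R) : R := Num.sqrt (dot x x).

Definition unit_ball : set (n.-tuple R) := [set x | enorm x <= 1].

Definition h1 (K : set (n.-tuple R)) (y : n.-tuple R) : \bar R :=
  lne ((\int[leb]_(x in K) (expR (dot x y))%:E) / leb K)%E.

Definition mahler1_body (K : set (n.-tuple R)) : \bar R :=
  (leb K * \int[leb]_y expeR (- h1 K y))%E.

Definition fvolume (f : n.-tuple R -> \bar R) : \bar R :=
  (\int[leb]_x expeR (- f x))%E.

Definition polar1 (f : n.-tuple R -> \bar R) (y : n.-tuple R) : \bar R :=
  lne ((\int[leb]_x expeR ((dot x y)%:E - 2%:E * f x)) / fvolume f)%E.

Definition mahler1_fun (f : n.-tuple R -> \bar R) : \bar R :=
  (fvolume f * \int[leb]_y expeR (- polar1 f y))%E.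

Definition q2 (x : n.-tuple R) : \bar R := (enorm x ^+ 2 / 2)%:E.

End Mahler.

Section Bessel.
Variable R : realType.

(* Euler's integral; meaningful for x > 0 only. *)
Definition Gamma (x : R) : R :=
  (\int[lebesgue_measure]_(t in `]0%R, +oo[) (t `^ (x - 1) * expR (- t)))%R.

(* Real powers `^ are used, so this is meant for x >= 0 and alpha > -1. *)
Definition besselI (alpha x : R) : R :=
  limn (series (fun m : nat =>
    (x / 2) `^ ((2 * m)%:R + alpha) / (m`!%:R * Gamma (m%:R + alpha + 1)))).

End Bessel.

(* a_n = b_n e^{o(n)}, for sequences indexed by the dimension n >= 1. *)
Definition eq_up_to_expo (R : realType) (a b : nat -> \bar R) : Prop :=
  exists c : nat -> R,
    [/\ forall n, (0 < n)%N -> 0 < c n,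
        (fun n : nat => n%:R^-1 * ln (c n)) @ \oo --> (0 : R)
      & forall n, (0 < n)%N -> a n = (b n * (c n)%:E)%E].

(* Main.v *)
Require Import Defs.
From HB Require Import structures.
From mathcomp Require Import all_boot all_order all_algebra.
From mathcomp Require Import all_classical all_reals all_analysis.
From mathcomp Require Import measurable_realfun ring lra.
Import Order.TTheory GRing.Theory Num.Theory.
Import numFieldTopology.Exports numFieldNormedType.Exports.
Local Open Scope classical_set_scope.
Local Open Scope ring_scope.

(** Write D(y) for the integral of e^<x,y> over the unit ball B
    ([laplace_ball]), so that M_1(B) = |B| * int |B| / D(y) dy, and write
    a ~ b when a / b = e^o(n).  Everything is determined by exponential rates,
    so crude inequalities are enough as long as their parameters are tuned to
    the place where the integrals concentrate, namely |y| near sqrt 2 * n.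

    M_1(q_2) is a product of Gaussian integrals and equals (4 pi)^n
    ([mahler1_q2]).

    Lower bound for M_1(B) ([mahler1_ball_ge]): the indicator of B is at most
    e^(n (1 - |x|^2)), so D is at most a multiple of a Gaussian in y, and the
    integral of 1 / D is at least a Gaussian integral.  This gives
    |B|^2 (2 n / e)^n, and |B| = pi^(n/2) / Gamma(n/2 + 1) ~ (2 pi e / n)^(n/2)
    turns it into (4 pi)^n.

    Upper bound for M_1(B) ([mahler1_ball_le]): by Chernoff's inequality at least
    half of the ball lies in a thin slab orthogonal to y ([slab_ge]).  Shrinking this
    slab by a factor r and moving it by t in the direction of y keeps it inside
    B when r and t are close to 1 / sqrt 2, and e^<x,y> is at least about
    e^(t |y|) on it.  Hence D(y) is at least roughly |B| 2^(-n/2) e^(|y| / sqrt 2).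
    Since the integral of e^(-c |y|) is |B| Gamma(n + 1) / c^n, this leads to the
    bound |B|^2 2^n Gamma(n + 1) ~ (4 pi)^n.

    The Bessel integral is treated in the same way on the side of the series.
    The inequality 1 / Gamma(z + 1) <= e^l l^(-z), valid for every l > 0, bounds
    I_(n/2)(r) by an explicit Gaussian in r ([besselI_le]); with l = n this is
    sharp near r = sqrt 2 * n, where the integrand is largest, and an interval
    of length 1 there already carries the whole integral up to e^o(n)
    ([bessel_integral_ge]).  Conversely, keeping only the term of index close to
    n / 2 of the series for r >= 1, and the first term for r <= 1, makes the
    integrand at most a multiple of 1 / (1 + r^2) in which the constant has the
    right exponential rate ([bessel_integral_le]). *)

Set Implicit Arguments.
Unset Strict Implicit.
Unset Printing Implicit Defensive.

(** * Monotonicity of integrals of nonnegative functions *)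
Section Monotone.
Context d (T : measurableType d) (R : realType).
Variable mu : {measure set T -> \bar R}.
Local Open Scope ereal_scope.

(** The integral of a nonnegative function is a supremum over the simple
    functions below it, hence monotone for arbitrary functions.  It serves to
    compare 1 / D(y) and 1 / I_(n/2)(r) with elementary functions. *)
Lemma ge0_integral_mono (D : set T) (f g : T -> \bar R) :
  (forall x, D x -> 0 <= f x) -> (forall x, D x -> f x <= g x) ->
  \int[mu]_(x in D) f x <= \int[mu]_(x in D) g x.
Proof.
move=> f0 fg; rewrite !(integral_mkcond D).
rewrite !ge0_integralTE; last 2 first.
- move=> x; apply: erestrict_ge0 => {}x Dx.
  exact: le_trans (f0 _ Dx) (fg _ Dx).
- by move=> x; apply: erestrict_ge0.
apply: ereal_sup_le => _ [h hf <-]; exists h => // x.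
by apply: le_trans (hf x) _; apply: lee_restrict.
Qed.

Lemma ge0_integral_mono_set (A B : set T) (f : T -> \bar R) :
  (forall x, B x -> 0 <= f x) -> A `<=` B ->
  \int[mu]_(x in A) f x <= \int[mu]_(x in B) f x.
Proof.
move=> f0 AB; rewrite (integral_mkcond A) (integral_mkcond B).
apply: ge0_integral_mono => x _.
  by apply: erestrict_ge0 => {}x /AB /f0.
rewrite !patchE; case: ifPn => [/set_mem/AB Bx|_].
  by rewrite mem_set.
by case: ifPn => // /set_mem/f0.
Qed.

End Monotone.

(** * Affine changes of variables and Gaussian integrals in R^n *)
Section AffineR.
Variable R : realType.
Local Notation lam := (@lebesgue_measure R).
Local Open Scope ereal_scope.

Let affine (r v : R) : R -> R := fun x => (r * x + v)%R.

Let measurable_affine r v : measurable_fun setT (affine r v).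
Proof. exact: measurable_funD. Qed.

(** Lebesgue measure is characterized by its value on half-open intervals, so
    it is r times its image under x |-> r x + v. *)
Lemma ge0_integral_affine (r v : R) (f : R -> \bar R) : (0 < r)%R ->
  measurable_fun setT f -> (forall x, 0 <= f x) ->
  \int[lam]_x f x = r%:E * \int[lam]_x f (r * x + v)%R.
Proof.
move=> r0 mf f0.
have rge0 : (0 <= r)%R by exact: ltW.
pose phi : measurableTypeR R -> measurableTypeR R := affine r v.
have mphi : measurable_fun [set: measurableTypeR R] phi.
  exact: measurable_affine.
pose pf : {measure set (measurableTypeR R) -> \bar R} :=
  measure_function_pushforward__canonical__measure_function_Measure lam mphi.
pose nu := mscale (NngNum rge0) pf.
have lamE A : measurable A -> lam A = nu A.
  apply: lebesgue_measure_unique => _ [[a b] /= _ <-].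
  rewrite /nu /mscale /= /pushforward.
  rewrite (_ : phi @^-1` _ =
    `]((a - v) / r)%R, ((b - v) / r)%R]%classic); last first.
    apply/seteqP; split=> x /=; rewrite !in_itv/=.
      move=> /andP[h1 h2]; rewrite ltr_pdivrMr// ler_pdivlMr//.
      by move: h1 h2; rewrite /phi /affine => *; apply/andP; split; lra.
    rewrite ltr_pdivrMr// ler_pdivlMr// => /andP[h1 h2].
    by rewrite /phi /affine; apply/andP; split; lra.
  rewrite !lebesgue_measure_itv/= !lte_fin ltr_pM2r ?invr_gt0// ltrD2r.
  case: ifPn => _; last by rewrite mule0.
  by rewrite -!EFinB -EFinM; congr EFin; field; rewrite gt_eqF.
rewrite (eq_measure_integral nu); last by move=> A mA _; exact: lamE.
rewrite ge0_integral_mscale//=; congr (_ * _).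
exact: (ge0_integral_pushforward mphi lam measurableT mf (in1W f0)).
Qed.

End AffineR.

Section Tuple.
Variable R : realType.
Local Notation lam := (@lebesgue_measure R).
Local Notation leb n := (lebesgue_tuple R n).

Lemma integral_lebesgue_tuple0 (f : 0.-tuple R -> \bar R) :
  measurable_fun setT f -> (\int[leb 0]_x f x = f [tuple])%E.
Proof. by move=> mf; rewrite integral_dirac// diracT mul1e. Qed.

(** Tonelli's theorem for the decomposition of R^(n+1) into R x R^n. *)
Lemma ge0_integral_lebesgue_tupleS n (f : n.+1.-tuple R -> \bar R) :
  measurable_fun setT f -> (forall x, 0 <= f x)%E ->
  (\int[leb n.+1]_x f x =
   \int[lam]_x \int[leb n]_t f (tuple_of_pair (x, t)))%E.
Proof.
move=> mf f0.
pose lam' : {sigma_finite_measure set (measurableTypeR R) -> \bar R} := lam.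
pose phi : measurableTypeR R * n.-tuple R -> n.+1.-tuple R :=
  @tuple_of_pair R n.
have mphi : measurable_fun [set: measurableTypeR R * n.-tuple R] phi.
  exact: measurable_tuple_of_pair.
have mg : measurable_fun setT (f \o phi) by exact: measurableT_comp.
transitivity (\int[(lam' \x leb n)%E]_z (f \o phi) z)%E; last first.
  exact: (fubini_tonelli1 (f \o phi) mg (fun x => f0 (phi x))).
pose pf : {measure set _ -> \bar R} :=
  measure_function_pushforward__canonical__measure_function_Measure
    (lam' \x leb n)%E mphi.
rewrite (eq_measure_integral pf); last by move=> A _ _.
exact: (ge0_integral_pushforward mphi _ measurableT mf (in1W f0)).
Qed.

Definition affine_tuple n (r : R) (v x : n.-tuple R) : n.-tuple R :=
  [tuple r * tnth x i + tnth v i | i < n].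

Lemma measurable_affine_tuple n r (v : n.-tuple R) :
  measurable_fun setT (affine_tuple r v).
Proof.
apply/measurable_fun_tnthP => i.
rewrite (_ : _ \o _ = fun x => r * tnth x i + tnth v i); last first.
  by apply/funext => x /=; rewrite tnth_mktuple.
apply: measurable_funD => //; apply: measurable_funM => //.
exact: measurable_tnth.
Qed.

Lemma affine_tuple_cons n r (v : n.+1.-tuple R) x t :
  affine_tuple r v (tuple_of_pair (x, t)) =
  tuple_of_pair (r * x + thead v, affine_tuple r [tuple of behead v] t).
Proof.
apply: eq_from_tnth => i; rewrite tnth_mktuple.
have [j ->|->] := unliftP ord0 i; last by [].
rewrite !tnthS tnth_mktuple tnth_behead.
by congr (_ + tnth v _); apply: val_inj; rewrite /= inordK// ltnS.
Qed.

Lemma ge0_integral_affine_tuple n (r : R) (v : n.-tuple R)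
    (f : n.-tuple R -> \bar R) : 0 < r ->
  measurable_fun setT f -> (forall x, 0 <= f x)%E ->
  (\int[leb n]_x f x = (r ^+ n)%:E * \int[leb n]_x f (affine_tuple r v x))%E.
Proof.
move=> r0; elim: n v f => [|n IHn] v f mf f0.
  rewrite !integral_lebesgue_tuple0//; last first.
    exact: measurableT_comp mf (measurable_affine_tuple _ _).
  by rewrite expr0 mul1e; congr f; apply: eq_from_tnth => -[].
have mg (x : R) : measurable_fun setT (fun t => f (tuple_of_pair (x, t))).
  apply: (measurableT_comp mf).
  by apply: measurable_cons; [exact: measurable_cst|exact: measurable_id].
rewrite ge0_integral_lebesgue_tupleS// ge0_integral_lebesgue_tupleS//; last first.
  exact: measurableT_comp mf (measurable_affine_tuple _ _).
set g := fun x : R => (\int[leb n]_t f (tuple_of_pair (x, t)))%E.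
have mG : measurable_fun setT g.
  apply: (measurable_fun_fubini_tonelli_F (f \o @tuple_of_pair R n)) => //=.
  exact: measurableT_comp mf (@measurable_tuple_of_pair R n).
have g0 x : (0 <= g x)%E by exact: integral_ge0.
rewrite (@ge0_integral_affine _ r (thead v) g)//.
rewrite exprS EFinM -muleA; congr (_ * _)%E.
rewrite -ge0_integralZl//; first last.
- by rewrite lee_fin exprn_ge0// ltW.
- by move=> x _; exact: integral_ge0.
- apply: (measurable_fun_fubini_tonelli_F
    (f \o affine_tuple r v \o @tuple_of_pair R n)) => //=.
  apply: measurableT_comp (@measurable_tuple_of_pair R n) => /=.
  exact: measurableT_comp mf (measurable_affine_tuple _ _).
apply: eq_integral => x _; rewrite /g (IHn [tuple of behead v])//.
by congr (_ * _)%E; apply: eq_integral => t _; rewrite affine_tuple_cons.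
Qed.

End Tuple.

Section Gauss.
Variable R : realType.
Local Notation lam := (@lebesgue_measure R).
Local Notation leb n := (lebesgue_tuple R n).

(** Completing the square is an affine change of variables in the Gaussian
    integral. *)
Lemma integral_gauss_shift (b y : R) : 0 < b ->
  (\int[lam]_x (expR (x * y - b * x ^+ 2))%:E =
   (Num.sqrt (pi / b) * expR (y ^+ 2 / (4 * b)))%:E)%E.
Proof.
move=> b0; have sb0 : 0 < Num.sqrt b by rewrite sqrtr_gt0.
have mg : measurable_fun setT (fun x : R => (gauss_fun x)%:E).
  by apply/measurable_EFinP; exact: measurable_gauss_fun.
have := @integralT_gauss R.
rewrite (@ge0_integral_affine _ (Num.sqrt b) (- (y / (2 * Num.sqrt b))))//; last first.
  by move=> x; rewrite lee_fin gauss_fun_ge0.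
rewrite [X in (_ * X)%E](_ : _ = (\int[lam]_x ((expR (- (y ^+ 2 / (4 * b))))%:E *
    (expR (x * y - b * x ^+ 2))%:E))%E); last first.
  apply: eq_integral => x _; rewrite -EFinM -expRD; congr (expR _)%:E.
  rewrite -[in RHS](sqr_sqrtr (ltW b0)).
  by field; rewrite gt_eqF.
rewrite ge0_integralZl//; last first.
  apply/measurable_EFinP; apply: measurableT_comp => //.
  apply: measurable_funB; first exact: measurable_funM.
  by apply: measurable_funM => //; exact: measurable_funX.
set I := (\int[_]_x _)%E => H.
have : ((expR (y ^+ 2 / (4 * b)) / Num.sqrt b)%:E *
    ((Num.sqrt b)%:E * ((expR (- (y ^+ 2 / (4 * b))))%:E * I)) =
    (expR (y ^+ 2 / (4 * b)) / Num.sqrt b)%:E * (Num.sqrt pi)%:E)%E.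
  by rewrite H.
rewrite !muleA -!EFinM mulfVK ?gt_eqF// -expRD subrr expR0 mul1e => ->.
by rewrite sqrtrM ?pi_ge0// sqrtrV ?ltW//; congr EFin; ring.
Qed.

Lemma measurable_fun_dot d (T : measurableType d) n (f g : T -> n.-tuple R) :
  measurable_fun setT f -> measurable_fun setT g ->
  measurable_fun setT (fun x => dot (f x) (g x)).
Proof.
move=> mf mg; apply: measurable_sum => i; apply: measurable_funM.
  exact: measurableT_comp (measurable_tnth i) mf.
exact: measurableT_comp (measurable_tnth i) mg.
Qed.

Lemma dot_cons n x (t : n.-tuple R) (y : n.+1.-tuple R) :
  dot (tuple_of_pair (x, t)) y = x * thead y + dot t [tuple of behead y].
Proof.
rewrite /dot big_ord_recl; congr (_ + _); apply: eq_bigr => i _.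
rewrite tnthS tnth_behead; congr (_ * tnth y _).
by apply: val_inj; rewrite /= inordK// ltnS.
Qed.

Lemma dot_consxx n x (t : n.-tuple R) :
  dot (tuple_of_pair (x, t)) (tuple_of_pair (x, t)) = x ^+ 2 + dot t t.
Proof.
by rewrite dot_cons expr2; congr (_ + dot _ _); apply: val_inj.
Qed.

Lemma dot_eta n (y : n.+1.-tuple R) :
  dot y y = thead y ^+ 2 + dot [tuple of behead y] [tuple of behead y].
Proof. by rewrite -dot_consxx (pair_of_tupleK y). Qed.

Lemma measurable_gauss n (b : R) (y : n.-tuple R) :
  measurable_fun setT (fun x => (expR (dot x y - b * dot x x))%:E).
Proof.
apply/measurable_EFinP; apply: measurableT_comp => //.
apply: measurable_funB; last apply: measurable_funM => //.
  exact: measurable_fun_dot.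
exact: measurable_fun_dot.
Qed.

(** The integrand is a product over the coordinates. *)
Lemma integral_gauss_tuple n (b : R) (y : n.-tuple R) : 0 < b ->
  (\int[leb n]_x (expR (dot x y - b * dot x x))%:E =
   (Num.sqrt (pi / b) ^+ n * expR (dot y y / (4 * b)))%:E)%E.
Proof.
move=> b0; elim: n y => [|n IHn] y.
  rewrite integral_lebesgue_tuple0; last exact: measurable_gauss.
  by rewrite /dot !big_ord0 mulr0 subr0 mul0r expR0 expr0 mulr1.
rewrite ge0_integral_lebesgue_tupleS; first last.
- by move=> x; rewrite lee_fin expR_ge0.
- exact: measurable_gauss.
have mgs (z : R) : measurable_fun setT
    (fun x : R => (expR (x * z - b * x ^+ 2))%:E).
  apply/measurable_EFinP; apply: measurableT_comp => //.
  apply: measurable_funB; first exact: measurable_funM.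
  by apply: measurable_funM => //; exact: measurable_funX.
rewrite [LHS](_ : _ = (\int[lam]_x (
    (Num.sqrt (pi / b) ^+ n *
     expR (dot [tuple of behead y] [tuple of behead y] / (4 * b)))%:E *
    (expR (x * thead y - b * x ^+ 2))%:E))%E); last first.
  apply: eq_integral => x _; rewrite muleC -IHn -ge0_integralZl//; last first.
    exact: measurable_gauss.
  apply: eq_integral => t _; rewrite dot_cons dot_consxx -EFinM -expRD.
  by congr (expR _)%:E; ring.
rewrite ge0_integralZl//; last exact: mgs.
rewrite integral_gauss_shift// -EFinM; congr EFin.
rewrite dot_eta [(_ + _) / (4 * b)]mulrDl expRD [_ ^+ n.+1]exprS; ring.
Qed.

End Gauss.

(** * The exponential layer cake formula *)
Section LayerCake.
Variable R : realType.
Local Notation lam := (@lebesgue_measure R).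

Lemma integral_expR_tail (c a : R) : 0 < c ->
  (\int[lam]_(s in `[a, +oo[) (expR (- (c * s)))%:E =
   (expR (- (c * a)) / c)%:E)%E.
Proof.
move=> c0.
have dF (x : R) : is_derive x (1 : R)
    (fun s : R => - (c^-1 * expR (- (c * s)))) (expR (- (c * x))).
  apply: is_derive_eq; rewrite /GRing.scale/=; field; rewrite gt_eqF//.
have cE : continuous (fun s : R => expR (- (c * s))).
  move=> x; apply: continuous_comp; last exact: continuous_expR.
  by apply: continuousN; exact: mulrl_continuous.
rewrite (@ge0_continuous_FTC2y _ _ (fun s => - (c^-1 * expR (- (c * s)))) a 0)//.
- by rewrite sub0e -EFinN opprK mulrC.
- exact: continuous_subspaceT.
- rewrite -oppr0 -(mulr0 c^-1); apply: cvgN; apply: cvgMr.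
  apply: (@cvg_comp _ _ _ (fun s => c * s) (fun s => expR (- s)) _
    (pinfty_nbhs R)); last exact: cvgr_expR.
  exact: gt0_cvgMry.
- apply: cvg_at_right_filter; apply: cvgN; apply: cvgMr; exact: cE.
- by move=> x _; rewrite derive1E (@derive_val _ _ _ _ _ _ _ (dF x)).
Qed.

Lemma integral_expRN_tail (a : R) :
  (\int[lam]_(s in `[a, +oo[) (expR (- s))%:E = (expR (- a))%:E)%E.
Proof.
have := integral_expR_tail a ltr01; rewrite mul1r divr1 => <-.
by apply: eq_integral => s _; rewrite mul1r.
Qed.

(** Write e^(-g(x)) as the integral of e^(-s) over s >= g(x) and exchange the two
    integrals.  When the measure of the sublevel sets of g is a power of s, the
    right-hand side is a value of Gamma. *)
Lemma exp_layer_cake d (T : measurableType d)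
    (mu : {sigma_finite_measure set T -> \bar R}) (g : T -> R) :
  measurable_fun setT g -> (forall x, 0 <= g x) ->
  (\int[mu]_x (expR (- g x))%:E =
   \int[lam]_(s in `]0%R, +oo[) ((expR (- s))%:E * mu [set x | (g x <= s)%R]))%E.
Proof.
move=> mg g0.
pose h (p : T * measurableTypeR R) : \bar R :=
  if (g p.1 <= p.2) && (0 < p.2) then (expR (- p.2))%:E else 0%E.
have mh : measurable_fun setT h.
  apply: measurable_fun_ifT => //=.
    apply: measurable_and.
      by apply: measurable_fun_ler => //; exact: measurableT_comp.
    by apply: measurable_fun_ltr.
  by apply/measurable_EFinP; do 2 apply: measurableT_comp => //.
have h0 p : (0 <= h p)%E.
  by rewrite /h; case: ifP => // _; rewrite lee_fin expR_ge0.
transitivity (\int[mu]_x \int[lam]_s h (x, s))%E.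
  apply: eq_integral => x _.
  have me D : measurable_fun D (fun s : R => (expR (- s))%:E).
    by apply/measurable_EFinP/measurable_funTS; apply: measurableT_comp.
  rewrite -integral_expRN_tail.
  transitivity (\int[lam]_(s in [set s : R | ((g x <= s) && (0 < s))%R])
      (expR (- s))%:E)%E.
    have [gx0|gx0] := ltP 0 (g x).
      congr (integral _ _ _); apply/seteqP; split=> s /=; rewrite in_itv/= andbT.
        by move=> gs; rewrite gs (lt_le_trans gx0 gs).
      by case/andP.
    have -> : g x = 0 by apply/eqP; rewrite eq_le gx0 g0.
    rewrite -integral_itv_obnd_cbnd//.
    congr (integral _ _ _); apply/seteqP; split=> s /=; rewrite in_itv/= andbT.
      by move=> gs; rewrite gs ltW.
    by case/andP.
  rewrite integral_mkcond; apply: eq_integral => s _.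
  rewrite patchE /h /=; case: ifPn => [/set_mem/= ->//|].
  by move=> /negP gs; case: ifP => // gs'; exfalso; apply/gs/mem_set.
rewrite (fubini_tonelli h)// [RHS]integral_mkcond; apply: eq_integral => s _.
rewrite patchE; case: ifPn => [/set_mem|/negP s0]; last first.
  rewrite integral0_eq// => x _; rewrite /h/=; case: ifP => // /andP[_ s1].
  by exfalso; apply/s0/mem_set; rewrite /= in_itv/= s1.
rewrite /= in_itv/= andbT => s0.
have mgs : measurable [set x | g x <= s].
  rewrite -[X in measurable X]setTI -preimage_itvNyc.
  exact: mg.
rewrite -[in RHS](setIT [set x | g x <= s]) -integral_indic//.
rewrite -ge0_integralZl//; last first.
  by apply/measurable_EFinP; exact: measurable_indic.
apply: eq_integral => x _; rewrite /h/= s0 andbT indicE.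
have [gs|gs] := leP (g x) s; first by rewrite mem_set// mule1.
by rewrite memNset ?mule0//=; apply/negP; rewrite -ltNge.
Qed.

End LayerCake.

(** * Gamma and factorials up to polynomial factors *)
Section GammaBounds.
Variable R : realType.
Local Notation lam := (@lebesgue_measure R).
Implicit Types z t c x : R.

Lemma ln_le_subr1 x : 0 < x -> ln x <= x - 1.
Proof.
by move=> x0; rewrite -{1}(subrKC 1 x); apply: le_ln1Dx; lra.
Qed.

Lemma powR_expR t z : 0 < t -> t `^ z = expR (z * ln t).
Proof. by move=> t0; rewrite /powR gt_eqF. Qed.

(** (z / e)^z *)
Definition stirling z := expR (z * ln z - z).

(** The maximum over t of t^z e^(-c t) is (z / (c e))^z; the remaining factor
    e^(-(1 - c) t) has integral 1 / (1 - c). *)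
Lemma Gamma_integral_le z c : 0 < z -> 0 < c -> c < 1 ->
  (\int[lam]_(t in `]0%R, +oo[) (t `^ z * expR (- t))%:E <=
   (expR (z * ln (z / c) - z) / (1 - c))%:E)%E.
Proof.
move=> z0 c0 c1.
have c1' : 0 < 1 - c by rewrite subr_gt0.
have mg D : measurable_fun D (fun t : R => (expR (- ((1 - c) * t)))%:E).
  apply/measurable_EFinP/measurable_funTS; apply: measurableT_comp => //.
  by apply: measurableT_comp => //.
apply: (@le_trans _ _ (\int[lam]_(t in `]0%R, +oo[)
    ((expR (z * ln (z / c) - z))%:E * (expR (- ((1 - c) * t)))%:E))%E).
  apply: ge0_integral_mono => t /=; rewrite in_itv/= andbT => t0.
    by rewrite lee_fin mulr_ge0// powR_ge0.
  rewrite -EFinM lee_fin powR_expR// -!expRD ler_expR.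
  have : ln (t * c / z) <= t * c / z - 1.
    by apply: ln_le_subr1; rewrite divr_gt0// mulr_gt0.
  rewrite -[t * c / z]mulrA -[c / z]invf_div lnM ?posrE ?invr_gt0 ?divr_gt0//.
  rewrite lnV ?posrE ?divr_gt0// => h.
  have : z * (ln t - ln (z / c)) <= z * (t / (z / c) - 1).
    by rewrite ler_pM2l.
  have -> : z * (t / (z / c) - 1) = t * c - z by field; rewrite !gt_eqF.
  by move=> {}h; lra.
rewrite ge0_integralZl//; last exact: mg.
rewrite integral_itv_obnd_cbnd ?integral_expR_tail//.
by rewrite mulr0 oppr0 expR0 div1r -EFinM.
Qed.

Lemma GammaE z : 0 < z ->
  ((Gamma (z + 1))%:E =
   \int[lam]_(t in `]0%R, +oo[) (t `^ z * expR (- t))%:E)%E.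
Proof.
move=> z0; rewrite /Gamma /Rintegral addrK fineK//.
rewrite ge0_fin_numE; last first.
  by apply: integral_ge0 => t _; rewrite lee_fin mulr_ge0// powR_ge0.
by apply: le_lt_trans (@Gamma_integral_le z 2^-1 z0 _ _) (ltry _); lra.
Qed.

(** Keep only t >= l in Euler's integral, where t^z >= l^z.  The best choice is
    l = z, but a fixed l makes the bounds on all the terms of the Bessel series
    summable in closed form. *)
Lemma Gamma_ge z l : 0 < z -> 0 < l -> expR (z * ln l - l) <= Gamma (z + 1).
Proof.
move=> z0 l0; rewrite -lee_fin GammaE//.
have me D : measurable_fun D (fun s : R => (expR (- s))%:E).
  by apply/measurable_EFinP/measurable_funTS; apply: measurableT_comp.
apply: (@le_trans _ _ (\int[lam]_(t in `[l, +oo[)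
    ((l `^ z)%:E * (expR (- t))%:E))%E).
  rewrite ge0_integralZl ?lee_fin ?powR_ge0//; last exact: me.
  by rewrite integral_expRN_tail -EFinM powR_expR// -expRD.
apply: (@le_trans _ _ (\int[lam]_(t in `[l, +oo[) (t `^ z * expR (- t))%:E)%E).
  apply: ge0_integral_mono => t /=; rewrite in_itv/= andbT => lt.
    by rewrite lee_fin mulr_ge0// powR_ge0.
  rewrite -EFinM lee_fin ler_wpM2r ?expR_ge0//.
  by rewrite ge0_ler_powR ?nnegrE// ?ltW// (lt_le_trans l0).
apply: ge0_integral_mono_set => t /=; rewrite !in_itv/= !andbT => lt.
  by rewrite lee_fin mulr_ge0// powR_ge0.
exact: lt_le_trans lt.
Qed.

Lemma Gamma_ge_stirling z : 0 < z -> stirling z <= Gamma (z + 1).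
Proof. by move=> z0; exact: Gamma_ge. Qed.

Lemma Gamma_gt0 z : 0 < z -> 0 < Gamma (z + 1).
Proof.
by move=> z0; apply: lt_le_trans (Gamma_ge_stirling z0); exact: expR_gt0.
Qed.

(** The choice c = z / (z + 1) in [Gamma_integral_le]. *)
Lemma Gamma_le_stirling z : 0 < z ->
  Gamma (z + 1) <= expR 1 * (z + 1) * stirling z.
Proof.
move=> z0; have z1 : 0 < z + 1 by lra.
have : Gamma (z + 1) <= expR (z * ln (z / (z / (z + 1))) - z) / (1 - z / (z + 1)).
  rewrite -lee_fin GammaE//; apply: Gamma_integral_le => //.
    by rewrite divr_gt0.
  by rewrite ltr_pdivrMr//; lra.
move=> /le_trans; apply.
have -> : z / (z / (z + 1)) = z * (1 + z^-1) by field; rewrite !gt_eqF.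
have -> : 1 - z / (z + 1) = (z + 1)^-1 by field; rewrite gt_eqF.
rewrite invrK -mulrA mulrCA [leRHS]mulrC; apply: ler_wpM2r; first exact: ltW.
have zV : 0 < z^-1 by rewrite invr_gt0.
rewrite /stirling -expRD ler_expR lnM ?posrE//; last lra.
have : z * ln (1 + z^-1) <= z * z^-1.
  by rewrite ler_pM2l//; apply: le_ln1Dx; lra.
rewrite mulfV ?gt_eqF//; lra.
Qed.

(** The indices in the Bessel series are integers while n / 2 may be a
    half-integer; rounding costs only a linear factor. *)
Lemma stirling_shift (x e : R) : 0 < x -> 0 <= e <= 1 ->
  stirling (x + e) <= (x + 1) * stirling x.
Proof.
move=> x0 /andP[e0 e1]; have x1 : 0 < x + 1 by lra.
have xe : 0 < x + e by lra.
rewrite -[X in X * _](lnK x1) -expRD ler_expR.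
have h1 : ln (x + e) <= ln (x + 1) by rewrite ler_ln ?posrE//; lra.
have h2 : 0 <= ln (x + 1) by rewrite ln_ge0//; lra.
have h3 : e * ln (x + e) <= 1 * ln (x + 1).
  apply: (@le_trans _ _ (e * ln (x + 1))); first by rewrite ler_wpM2l.
  by rewrite ler_wpM2r.
have h4 : x * (ln (x + e) - ln x) <= e.
  rewrite -ln_div ?posrE//.
  apply: (@le_trans _ _ (x * ((x + e) / x - 1))).
    by rewrite ler_pM2l//; apply: ln_le_subr1; rewrite divr_gt0.
  by rewrite le_eqVlt; apply/orP; left; apply/eqP; field; rewrite gt_eqF.
lra.
Qed.

(** The induction step is ln (1 + 1 / z) >= 1 / (z + 1). *)
Lemma fact_le_stirling m : (0 < m)%N ->
  m`!%:R <= expR 1 * m%:R * stirling m%:R :> R.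
Proof.
elim: m => // -[_ _|m IHm _].
  by rewrite /stirling ln1 mulr0 sub0r mulr1 -expRD subrr expR0.
rewrite factS natrM.
apply: le_trans (ler_wpM2l _ (IHm isT)) _ => //.
rewrite -[m.+2]addn1 natrD; set z := m.+1%:R; have z0 : 0 < z by rewrite ltr0n.
rewrite [leLHS](_ : _ = expR 1 * (z + 1) * (z * stirling z)); last by ring.
apply: ler_wpM2l; first by rewrite mulr_ge0 ?expR_ge0//; lra.
rewrite -[X in X * _](lnK z0) -expRD ler_expR.
have : ln (z / (z + 1)) <= z / (z + 1) - 1.
  by apply: ln_le_subr1; rewrite divr_gt0//; lra.
rewrite ln_div ?posrE//; last lra.
have -> : z / (z + 1) - 1 = - (z + 1)^-1 by field; rewrite gt_eqF//; lra.
move=> h; have : (z + 1) * (ln z - ln (z + 1)) <= (z + 1) * - (z + 1)^-1.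
  by rewrite ler_pM2l//; lra.
rewrite mulrN mulfV; last by rewrite gt_eqF//; lra.
lra.
Qed.

End GammaBounds.

(** * Volume of the ball *)
Section Ball.
Variables (R : realType) (n : nat).
Local Notation lam := (@lebesgue_measure R).
Local Notation leb := (lebesgue_tuple R n).
Local Notation ball := (@unit_ball R n).
Implicit Types x y : n.-tuple R.

Lemma dotxx_ge0 x : 0 <= dot x x.
Proof. by apply: sumr_ge0 => i _; rewrite -expr2 sqr_ge0. Qed.

Lemma enorm_ge0 x : 0 <= enorm x.
Proof. exact: sqrtr_ge0. Qed.

Lemma sqr_enorm x : enorm x ^+ 2 = dot x x.
Proof. by rewrite sqr_sqrtr// dotxx_ge0. Qed.

Lemma measurable_dotxx : measurable_fun setT (fun x => dot x x).
Proof. exact: measurable_fun_dot. Qed.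

Lemma measurable_enorm : measurable_fun setT (@enorm R n).
Proof.
apply: (@measurableT_comp _ _ _ _ _ _ (@Num.sqrt R)); last exact: measurable_dotxx.
by apply: continuous_measurable_fun; exact: sqrt_continuous.
Qed.

Lemma measurable_enorm_le (s : R) :
  measurable [set x : n.-tuple R | enorm x <= s].
Proof.
rewrite -[X in measurable X]setTI -preimage_itvNyc.
exact: measurable_enorm.
Qed.

Lemma dotC x y : dot x y = dot y x.
Proof. by apply: eq_bigr => i _; rewrite mulrC. Qed.

Lemma dot_affinel (r : R) (v x y : n.-tuple R) :
  dot (affine_tuple r v x) y = r * dot x y + dot v y.
Proof.
rewrite /dot mulr_sumr -big_split; apply: eq_bigr => i _ /=.
by rewrite tnth_mktuple mulrDl mulrA.
Qed.

Lemma dot_affinexx (r : R) (v x : n.-tuple R) :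
  dot (affine_tuple r v x) (affine_tuple r v x) =
  r ^+ 2 * dot x x + 2 * r * dot x v + dot v v.
Proof.
rewrite dot_affinel (dotC x) (dotC v) !dot_affinel (dotC v x); ring.
Qed.

Definition zero_tuple : n.-tuple R := [tuple 0 | i < n].

Lemma dot0r x : dot x zero_tuple = 0.
Proof. by apply: big1 => i _; rewrite tnth_mktuple mulr0. Qed.

Lemma lebesgue_enorm_le (s : R) : 0 < s ->
  (leb [set x : n.-tuple R | (enorm x <= s)%R] = (s ^+ n)%:E * leb ball)%E.
Proof.
move=> s0.
rewrite -[in LHS](setIT [set x : n.-tuple R | enorm x <= s]) -integral_indic//; last first.
  exact: measurable_enorm_le.
rewrite -(setIT ball) -integral_indic//; last exact: measurable_enorm_le.
rewrite (@ge0_integral_affine_tuple _ _ s zero_tuple)//; last first.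
  by apply/measurable_EFinP/measurable_indic; exact: measurable_enorm_le.
congr (_ * _)%E; apply: eq_integral => x _; rewrite !indicE.
suff sE : (enorm (affine_tuple s zero_tuple x) <= s) = (enorm x <= 1).
  by congr ((nat_of_bool _)%:R%:E); apply/idP/idP; rewrite !inE /= /unit_ball/= sE.
rewrite /enorm dot_affinexx !dot0r mulr0 !addr0.
rewrite sqrtrM ?sqr_ge0// sqrtr_sqr gtr0_norm//.
by rewrite -ler_pdivlMl// mulVf ?gt_eqF.
Qed.

Definition ball_volume : R := Num.sqrt pi ^+ n / Gamma (n%:R / 2 + 1).

Hypothesis n0 : (0 < n)%N.

Lemma half_gt0 : 0 < n%:R / 2 :> R.
Proof. by rewrite divr_gt0// ltr0n. Qed.

Lemma ball_volume_gt0 : 0 < ball_volume.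
Proof.
by rewrite divr_gt0 ?exprn_gt0 ?sqrtr_gt0 ?pi_gt0// Gamma_gt0// half_gt0.
Qed.

(** The layer cake formula for g(x) = |x|^2: the integral of e^(-|x|^2) is both
    sqrt(pi)^n and |B| Gamma(n/2 + 1). *)
Lemma lebesgue_unit_ball : leb ball = ball_volume%:E.
Proof.
have G0 := @Gamma_gt0 R _ half_gt0.
suff H : ((Gamma (n%:R / 2 + 1))%:E * leb ball = (Num.sqrt pi ^+ n)%:E :> \bar R)%E.
  have : ((Gamma (n%:R / 2 + 1))^-1%:E * ((Gamma (n%:R / 2 + 1))%:E * leb ball) =
    (Gamma (n%:R / 2 + 1))^-1%:E * (Num.sqrt pi ^+ n)%:E)%E by rewrite H.
  rewrite muleA -!EFinM mulVf ?gt_eqF// mul1e => ->.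
  by rewrite mulrC.
have := @integral_gauss_tuple R n 1 zero_tuple ltr01.
rewrite dot0r mul0r expR0 mulr1 divr1 => <-.
transitivity (\int[leb]_x (expR (- dot x x))%:E)%E; last first.
  by apply: eq_integral => x _; rewrite dot0r sub0r mul1r.
rewrite (exp_layer_cake leb measurable_dotxx dotxx_ge0).
rewrite GammaE ?half_gt0// muleC -ge0_integralZl//; last first.
- by move=> t; rewrite /= in_itv/= andbT => t0; rewrite lee_fin mulr_ge0 ?powR_ge0.
- apply/measurable_EFinP/measurable_funTS; apply: measurable_funM.
    exact: measurable_powR.
  exact: measurableT_comp.
apply: eq_integral => s; rewrite inE/= in_itv/= andbT => s0.
rewrite (_ : [set x | _] = [set x : n.-tuple R | enorm x <= Num.sqrt s]); last first.
  by apply/seteqP; split=> x /=; rewrite /enorm ler_sqrt// ltW.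
rewrite (@lebesgue_enorm_le (Num.sqrt s)) ?sqrtr_gt0// muleA -EFinM muleC mulrC.
congr ((_ * _)%:E * _)%E.
by rewrite -powR12_sqrt ?ltW// -[RHS]powR_mulrn ?powR_ge0// -powRrM mulrC.
Qed.

(** The layer cake formula for g(x) = c |x|. *)
Lemma integral_expR_enorm (c : R) : 0 < c ->
  (\int[leb]_x (expR (- (c * enorm x)))%:E =
   (ball_volume * Gamma (n%:R + 1) / c ^+ n)%:E)%E.
Proof.
move=> c0.
have mc : measurable_fun setT (fun x => c * enorm x).
  by apply: measurable_funM => //; exact: measurable_enorm.
rewrite (exp_layer_cake leb mc); last first.
  by move=> x; apply: mulr_ge0; [exact: ltW|exact: enorm_ge0].
rewrite mulrAC EFinM GammaE ?ltr0n// -ge0_integralZl//; last first.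
- by rewrite lee_fin divr_ge0 ?exprn_ge0// ltW// ball_volume_gt0.
- by move=> t; rewrite /= in_itv/= andbT => t0; rewrite lee_fin mulr_ge0 ?powR_ge0.
- apply/measurable_EFinP/measurable_funTS; apply: measurable_funM.
    exact: measurable_powR.
  exact: measurableT_comp.
apply: eq_integral => s; rewrite inE/= in_itv/= andbT => s0.
rewrite (_ : [set x | _] = [set x : n.-tuple R | enorm x <= s / c]); last first.
  by apply/seteqP; split=> x /=; rewrite ler_pdivlMr// mulrC.
rewrite (@lebesgue_enorm_le (s / c)) ?divr_gt0// lebesgue_unit_ball -!EFinM; congr EFin.
by rewrite powR_mulrn ?ltW// expr_div_n; ring.
Qed.

End Ball.

(** * Reduction of the Mahler volumes to bounds on Laplace transforms *)
Section LneDiv.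
Variable R : realType.

Lemma expeR_oppe_lne_div (a b : R) : 0 < a -> 0 < b ->
  expeR (- lne (a%:E / b%:E))%E = (b / a)%:E.
Proof.
move=> a0 b0; rewrite inver gt_eqF// -EFinM lne_EFin ?divr_gt0//=.
by rewrite expRN lnK ?posrE ?divr_gt0// invf_div.
Qed.

Lemma expeR_oppe_lne_div_le (D : \bar R) (u v : R) : 0 < u -> 0 < v ->
  (u%:E <= D)%E -> (expeR (- lne (D / v%:E)) <= (v / u)%:E)%E.
Proof.
move=> u0 v0 uD; rewrite -expeR_oppe_lne_div// lee_expeR leeN2.
have D0 : (0 <= D)%E by apply: le_trans uD; rewrite lee_fin ltW.
have v0' : (0 <= v%:E^-1)%E by rewrite inver gt_eqF// lee_fin invr_ge0 ltW.
have uv0 : (0 <= u%:E / v%:E)%E by rewrite mule_ge0// lee_fin ltW.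
have Dv0 : (0 <= D / v%:E)%E by rewrite mule_ge0.
by rewrite lee_lne ?in_itv/= ?leey ?andbT//; exact: lee_wpmul2r.
Qed.

Lemma expeR_oppe_lne_div_ge (D : \bar R) (u v : R) : 0 < u -> 0 < v ->
  (0 <= D)%E -> (D <= u%:E)%E -> ((v / u)%:E <= expeR (- lne (D / v%:E)))%E.
Proof.
move=> u0 v0 D0 uD; rewrite -expeR_oppe_lne_div// lee_expeR leeN2.
have v0' : (0 <= v%:E^-1)%E by rewrite inver gt_eqF// lee_fin invr_ge0 ltW.
have uv0 : (0 <= u%:E / v%:E)%E by rewrite mule_ge0// lee_fin ltW.
have Dv0 : (0 <= D / v%:E)%E by rewrite mule_ge0.
by rewrite lee_lne ?in_itv/= ?leey ?andbT//; exact: lee_wpmul2r.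
Qed.

End LneDiv.

Section Body.
Variables (R : realType) (n : nat).
Local Notation leb := (lebesgue_tuple R n).
Local Notation ball := (@unit_ball R n).
Local Notation V := (@ball_volume R n).
Implicit Types x y z : n.-tuple R.

Lemma integral_gauss0 (b : R) : 0 < b ->
  (\int[leb]_x (expR (- (b * dot x x)))%:E = (Num.sqrt (pi / b) ^+ n)%:E)%E.
Proof.
move=> b0; have := @integral_gauss_tuple R n b (@zero_tuple R n) b0.
rewrite dot0r mul0r expR0 mulr1 => <-.
by apply: eq_integral => x _; rewrite dot0r sub0r.
Qed.

Lemma mahler1_q2 : mahler1_fun (@q2 R n) = ((4 * pi) ^+ n)%:E.
Proof.
have p0 := @pi_gt0 R.
have fv : fvolume (@q2 R n) = (Num.sqrt (2 * pi) ^+ n)%:E.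
  rewrite (_ : 2 * pi = pi / 2^-1); last by rewrite invrK mulrC.
  rewrite -integral_gauss0 ?invr_gt0//; apply: eq_integral => x _.
  by rewrite /q2 sqr_enorm /= mulrC.
have po y : expeR (- polar1 (@q2 R n) y) =
    ((Num.sqrt (2 * pi) / Num.sqrt pi) ^+ n * expR (- (4^-1 * dot y y)))%:E.
  rewrite /polar1 fv.
  have -> : (\int[leb]_x expeR ((dot x y)%:E - 2%:E * q2 x))%E =
      (Num.sqrt pi ^+ n * expR (dot y y / 4))%:E.
    have := @integral_gauss_tuple R n 1 y ltr01.
    rewrite mulr1 divr1 => <-; apply: eq_integral => x _.
    by rewrite /q2 sqr_enorm -EFinM -EFinB /= mul1r mulrCA mulfV// mulr1.
  rewrite expeR_oppe_lne_div ?mulr_gt0 ?exprn_gt0 ?expR_gt0 ?sqrtr_gt0 ?mulr_gt0//.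
  by rewrite expRN expr_div_n [4^-1 * _]mulrC invfM mulrA.
rewrite /mahler1_fun fv.
under eq_integral do rewrite po EFinM.
rewrite ge0_integralZl//; last first.
  apply/measurable_EFinP; apply: measurableT_comp => //.
  apply: measurableT_comp => //; apply: measurable_funM => //.
  exact: measurable_dotxx.
rewrite integral_gauss0 ?invr_gt0// -!EFinM -!exprMn; congr ((_ ^+ n)%:E).
have sp0 : Num.sqrt pi != 0 :> R by rewrite gt_eqF// sqrtr_gt0.
have -> : Num.sqrt (pi / 4^-1) = 2 * Num.sqrt pi :> R.
  rewrite invrK mulrC sqrtrM// (_ : 4 = 2 ^+ 2); last by ring.
  by rewrite sqrtr_sqr ger0_norm.
rewrite [LHS](_ : _ = 2 * Num.sqrt (2 * pi) ^+ 2); last by field.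
by rewrite sqr_sqrtr ?mulr_ge0 ?pi_ge0//; ring.
Qed.

Hypothesis n0 : (0 < n)%N.
Let V0 : 0 < V := ball_volume_gt0 R n0.
Let nR : 0 < n%:R :> R. Proof. by rewrite ltr0n. Qed.

Definition laplace_ball y : \bar R :=
  (\int[leb]_(x in ball) (expR (dot x y))%:E)%E.

Lemma mahler1_ballE : mahler1_body ball =
  (V%:E * \int[leb]_y expeR (- lne (laplace_ball y / V%:E)))%E.
Proof. by rewrite /mahler1_body /h1 (lebesgue_unit_ball R n0). Qed.

Lemma laplace_ball_ge0 y : (0 <= laplace_ball y)%E.
Proof. by apply: integral_ge0 => x _; rewrite lee_fin expR_ge0. Qed.

Lemma ballP x : ball x <-> dot x x <= 1.
Proof.
rewrite /unit_ball /= -sqr_enorm; split=> h.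
  by rewrite -[leRHS](expr1n _ 2) lerXn2r ?nnegrE ?enorm_ge0.
by rewrite -(@ler_pXn2r _ 2) ?nnegrE ?enorm_ge0// expr1n.
Qed.

(** The indicator of the ball is at most e^(n (1 - |x|^2)).  The factor n in the
    exponent minimizes the bound at |y| = sqrt 2 * n. *)
Lemma laplace_ball_le y : (laplace_ball y <=
  (expR n%:R * Num.sqrt (pi / n%:R) ^+ n * expR (dot y y / (4 * n%:R)))%:E)%E.
Proof.
rewrite -mulrA EFinM -integral_gauss_tuple// -ge0_integralZl//; last first.
  exact: measurable_gauss.
apply: (@le_trans _ _ (\int[leb]_(x in ball)
    ((expR n%:R)%:E * (expR (dot x y - n%:R * dot x x))%:E))%E); last first.
  by apply: ge0_integral_mono_set => // x _; rewrite -EFinM lee_fin mulr_ge0.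
apply: ge0_integral_mono => x /= Bx; first by rewrite lee_fin.
rewrite -EFinM lee_fin -expRD ler_expR.
have : n%:R * dot x x <= n%:R * 1 by rewrite ler_pM2l//; exact/ballP.
lra.
Qed.

Lemma mahler1_ball_ge :
  ((V ^+ 2 * (expR (- n%:R) * (2 * n%:R) ^+ n))%:E <= mahler1_body ball)%E.
Proof.
rewrite mahler1_ballE.
pose C : R := expR n%:R * Num.sqrt (pi / n%:R) ^+ n.
have C0 : 0 < C.
  by rewrite mulr_gt0 ?expR_gt0// exprn_gt0// sqrtr_gt0 divr_gt0// pi_gt0.
have b0 : 0 < (4 * n%:R)^-1 :> R by rewrite invr_gt0 mulr_gt0.
have s0 : 0 < Num.sqrt (pi / n%:R) :> R by rewrite sqrtr_gt0 divr_gt0 ?pi_gt0.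
have -> : V ^+ 2 * (expR (- n%:R) * (2 * n%:R) ^+ n) =
    V * (V / C * Num.sqrt (pi / (4 * n%:R)^-1) ^+ n).
  have -> : Num.sqrt (pi / (4 * n%:R)^-1) = 2 * n%:R * Num.sqrt (pi / n%:R) :> R.
    rewrite (_ : pi / (4 * n%:R)^-1 = (2 * n%:R) ^+ 2 * (pi / n%:R)); last first.
      by field; rewrite gt_eqF.
    by rewrite sqrtrM ?sqr_ge0// sqrtr_sqr ger0_norm// mulr_ge0.
  rewrite /C [(_ * Num.sqrt _) ^+ n]exprMn expRN; field.
  by rewrite !gt_eqF ?expR_gt0 ?exprn_gt0.
rewrite EFinM; apply: lee_wpmul2l; first by rewrite lee_fin ltW.
rewrite EFinM -integral_gauss0// -ge0_integralZl//; first last.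
- by rewrite lee_fin divr_ge0 ?ltW.
- apply/measurable_EFinP; apply: measurableT_comp => //.
  apply: measurableT_comp => //; apply: measurable_funM => //.
  exact: measurable_dotxx.
apply: ge0_integral_mono => y _.
  by rewrite -EFinM lee_fin mulr_ge0// divr_ge0 ?ltW.
have E0 : 0 < C * expR (dot y y / (4 * n%:R)) by rewrite mulr_gt0 ?expR_gt0.
have := expeR_oppe_lne_div_ge E0 V0 (laplace_ball_ge0 y) (laplace_ball_le y).
apply: le_trans; rewrite -EFinM lee_fin expRN [(C * _)^-1]invfM mulrA.
by rewrite [_^-1 * dot y y]mulrC.
Qed.

Lemma mahler1_ball_le_of_growth (L c : R) : 0 < L -> 0 < c ->
  (forall y, (L * expR (c * enorm y))%:E <= laplace_ball y)%E ->
  (mahler1_body ball <= (V ^+ 3 * Gamma (n%:R + 1) / (L * c ^+ n))%:E)%E.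
Proof.
move=> L0 c0 LD; rewrite mahler1_ballE.
have -> : V ^+ 3 * Gamma (n%:R + 1) / (L * c ^+ n) =
    V * (V / L * (V * Gamma (n%:R + 1) / c ^+ n)).
  by field; rewrite !gt_eqF// exprn_gt0.
rewrite [leRHS]EFinM; apply: lee_wpmul2l; first by rewrite lee_fin ltW.
rewrite [in leRHS]EFinM -integral_expR_enorm// -ge0_integralZl//; first last.
- by rewrite lee_fin divr_ge0 ?ltW.
- apply/measurable_EFinP; apply: measurableT_comp => //.
  apply: measurableT_comp => //; apply: measurable_funM => //.
  exact: measurable_enorm.
apply: ge0_integral_mono => y _; first exact: expeR_ge0.
have E0 : 0 < L * expR (c * enorm y) by rewrite mulr_gt0 ?expR_gt0.
apply: le_trans (expeR_oppe_lne_div_le E0 V0 (LD y)) _.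
by rewrite -EFinM lee_fin expRN [(L * _)^-1]invfM mulrA.
Qed.

End Body.

(** * Lower bound on the Laplace transform of the ball *)
Section Slab.
Variables (R : realType) (n : nat).
Local Notation leb := (lebesgue_tuple R n).
Local Notation ball := (@unit_ball R n).
Local Notation V := (@ball_volume R n).
Implicit Types x y z : n.-tuple R.

Lemma dot_scaler (c : R) y z :
  dot z (affine_tuple c (@zero_tuple R n) y) = c * dot z y.
Proof.
by rewrite dotC dot_affinel (dotC (zero_tuple _ _)) dot0r addr0 dotC.
Qed.

Definition slab (d : R) y : set (n.-tuple R) :=
  [set z | dot z z <= 1 /\ `|dot z y| <= d * enorm y].

Lemma measurable_dotl y : measurable_fun setT (fun x => dot x y).
Proof. exact: measurable_fun_dot. Qed.

Lemma measurable_ball : measurable ball.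
Proof. exact: measurable_enorm_le. Qed.

Lemma measurable_slab d y : measurable (slab d y).
Proof.
apply: measurableI; rewrite -[X in measurable X]setTI;
  apply: measurable_fun_le => //; first exact: measurable_dotxx.
by apply: measurableT_comp => //; exact: measurable_dotl.
Qed.

(** With u = y / |y|, the map z |-> t u + r z sends the slab into the ball,
    because |t u + r z|^2 <= t^2 + 2 t r d + r^2 there, and on its image <x,y> is
    at least (t - r d) |y|. *)
Lemma laplace_ball_slab (t r d : R) y : 0 <= t -> 0 < r -> 0 <= d ->
  t ^+ 2 + 2 * t * r * d + r ^+ 2 <= 1 ->
  ((r ^+ n * expR ((t - r * d) * enorm y))%:E * leb (slab d y) <=
   laplace_ball y)%E.
Proof.
move=> t0 r0 d0 tr1.
(* For y = 0 the convention t / 0 = 0 makes v the zero vector. *)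
pose v : n.-tuple R := affine_tuple (t / enorm y) (@zero_tuple R n) y.
have vE z : dot z v = t / enorm y * dot z y.
  exact: dot_scaler.
have ny : t / enorm y * enorm y <= t.
  have [->|y0] := eqVneq (enorm y) 0; first by rewrite mulr0.
  by rewrite divfK.
have ny0 : 0 <= t / enorm y * enorm y by rewrite mulr_ge0 ?divr_ge0 ?enorm_ge0.
pose f x : \bar R := (expR (dot x y) * \1_ball x)%:E.
have mf : measurable_fun setT f.
  apply/measurable_EFinP; apply: measurable_funM.
    by apply: measurableT_comp => //; exact: measurable_dotl.
  by apply: measurable_indic; exact: measurable_ball.
have f0 x : (0 <= f x)%E by rewrite lee_fin mulr_ge0 ?expR_ge0.
have -> : laplace_ball y = (\int[leb]_x f x)%E.
  rewrite /laplace_ball integral_mkcond; apply: eq_integral => x _.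
  by rewrite patchE /f indicE; case: ifP => _; rewrite ?mulr1 ?mulr0.
rewrite (ge0_integral_affine_tuple v r0 mf f0) EFinM -muleA.
apply: lee_wpmul2l; first by rewrite lee_fin exprn_ge0// ltW.
rewrite -(setIT (slab d y)) -integral_indic//; last exact: measurable_slab.
rewrite -ge0_integralZl//; last first.
  by apply/measurable_EFinP/measurable_indic; exact: measurable_slab.
apply: ge0_integral_mono => z _; first by rewrite -EFinM lee_fin mulr_ge0.
rewrite -EFinM lee_fin !indicE.
have [|zS] := boolP (z \in slab d y); last by rewrite mulr0 mulr_ge0 ?expR_ge0.
rewrite inE => -[z1 zy].
have qY : t / enorm y * enorm y ^+ 2 = t * enorm y.
  have [->|y0] := eqVneq (enorm y) 0; first by rewrite mulr0 expr0n mulr0.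
  by rewrite expr2 mulrA divfK.
have wB : ball (affine_tuple r v z).
  apply/ballP; rewrite dot_affinexx !vE (dotC v y) vE -(sqr_enorm y).
  set q := t / enorm y in ny ny0 qY *; set Y := enorm y in ny ny0 qY zy *.
  have q0 : 0 <= q by rewrite divr_ge0 ?enorm_ge0.
  have h1 : r ^+ 2 * dot z z <= r ^+ 2 by rewrite ler_piMr// sqr_ge0.
  have h2 : q * dot z y <= t * d.
    apply: (@le_trans _ _ (q * Y * d)); last by rewrite ler_wpM2r.
    by rewrite -mulrA ler_wpM2l// mulrC (le_trans (ler_norm _)).
  have h3 : (q * Y) ^+ 2 <= t ^+ 2 by rewrite lerXn2r ?nnegrE.
  have h4 : r * (q * dot z y) <= r * (t * d) by rewrite ler_wpM2l// ltW.
  rewrite exprMn in h3.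
  have -> : q * (q * Y ^+ 2) = q ^+ 2 * Y ^+ 2 by ring.
  lra.
rewrite mem_set//= !mulr1 ler_expR dot_affinel [dot v y]dotC vE -(sqr_enorm y) qY.
have /(ler_wpM2l (ltW r0)) : - (d * enorm y) <= dot z y by exact: lerNnormlW.
lra.
Qed.

(** Chernoff's bound ... *)
Definition cap (d : R) y : set (n.-tuple R) :=
  [set z | dot z z <= 1 /\ d * enorm y <= dot z y].

Lemma measurable_cap d y : measurable (cap d y).
Proof.
apply: measurableI; rewrite -[X in measurable X]setTI;
  apply: measurable_fun_le => //; first exact: measurable_dotxx.
exact: measurable_dotl.
Qed.

(** Chernoff's inequality: on the cap, the exponential of
    n/2 (1 - |z|^2) + s (<z,y> - d |y|) is at least 1 for every s >= 0; the best
    choice is s = n d / |y|. *)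
Lemma lebesgue_cap_le (d : R) y : (0 < n)%N -> 0 < enorm y -> 0 <= d ->
  (leb (cap d y) <=
   (expR (n%:R / 2) * Num.sqrt (pi / (n%:R / 2)) ^+ n *
    expR (- (n%:R * d ^+ 2 / 2)))%:E)%E.
Proof.
move=> n0 y0 d0; set b : R := n%:R / 2.
have h0 : 0 < b by rewrite divr_gt0// ltr0n.
have nE : n%:R = 2 * b :> R by rewrite /b mulrC divfK.
pose s := 2 * b * d / enorm y.
pose w : n.-tuple R := affine_tuple s (@zero_tuple R n) y.
have wE z : dot z w = s * dot z y.
  exact: dot_scaler.
have ww : dot w w = (2 * b * d) ^+ 2.
  rewrite wE (dotC w y) wE -(sqr_enorm y) /s; field; rewrite gt_eqF//.
have -> : expR b * Num.sqrt (pi / b) ^+ n * expR (- (n%:R * d ^+ 2 / 2)) =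
    expR (b - 2 * b * d ^+ 2) * (Num.sqrt (pi / b) ^+ n * expR (dot w w / (4 * b))).
  rewrite ww [RHS]mulrCA mulrAC mulrC -!expRD nE; congr (_ * expR _).
  by field; rewrite gt_eqF.
rewrite EFinM -integral_gauss_tuple// -ge0_integralZl//; last exact: measurable_gauss.
rewrite -(setIT (cap d y)) -integral_indic//; last exact: measurable_cap.
apply: ge0_integral_mono => z _ //.
rewrite -EFinM lee_fin indicE -expRD wE.
have [|zA] := boolP (z \in cap d y); last by rewrite expR_ge0.
rewrite inE => -[z1 zy]; rewrite -[leLHS]expR0 ler_expR.
have s0 : 0 <= s by rewrite divr_ge0 ?enorm_ge0// !mulr_ge0// ltW.
have h1 := ler_wpM2l s0 zy; have h2 := ler_wpM2l (ltW h0) z1.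
have h3 : s * (d * enorm y) = 2 * b * d ^+ 2 by rewrite /s; field; rewrite gt_eqF.
lra.
Qed.

Lemma dot_enorm0 y z : enorm y = 0 -> dot z y = 0.
Proof.
move=> y0; have /eqP := sqr_enorm y; rewrite y0 expr0n /= eq_sym.
rewrite psumr_eq0; last by move=> i _; rewrite -expr2 sqr_ge0.
move=> /allP yi; apply: big1 => i _.
by have := yi i (mem_index_enum i); rewrite mulf_eq0 orbb => /eqP ->; rewrite mulr0.
Qed.

Hypothesis n0 : (0 < n)%N.
Let b : R := n%:R / 2.
Let b0 : 0 < b. Proof. by rewrite divr_gt0// ltr0n. Qed.
Let V0 : 0 < V := ball_volume_gt0 R n0.

Lemma exprn_sqrt (x : R) : 0 < x -> Num.sqrt x ^+ n = expR (b * ln x).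
Proof.
move=> x0; rewrite -powR12_sqrt ?ltW// -powR_mulrn ?powR_ge0// -powRrM.
by rewrite powR_expR// /b [n%:R / 2]mulrC.
Qed.

(** The bound on caps is, up to the factor e^(-n d^2 / 2), the volume of the ball
    with Gamma replaced by its Stirling approximation. *)
Lemma gauss_peakE :
  expR b * Num.sqrt (pi / b) ^+ n = Num.sqrt pi ^+ n / stirling b.
Proof.
have p0 := @pi_gt0 R; have pb0 : 0 < pi / b by rewrite divr_gt0.
rewrite (exprn_sqrt pb0) (exprn_sqrt p0) ln_div ?posrE//.
by rewrite /stirling -expRN -!expRD; congr expR; ring.
Qed.

Lemma ball_volume_le : V <= Num.sqrt pi ^+ n / stirling b.
Proof.
rewrite ler_wpM2l ?exprn_ge0// lef_pV2 ?posrE ?expR_gt0 ?Gamma_gt0//.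
exact: Gamma_ge_stirling.
Qed.

Lemma ball_volume_ge :
  Num.sqrt pi ^+ n / stirling b <= expR 1 * (b + 1) * V.
Proof.
have sp0 : 0 < Num.sqrt pi ^+ n :> R by rewrite exprn_gt0// sqrtr_gt0 pi_gt0.
rewrite /ball_volume mulrCA ler_pM2l// ler_pdivlMr ?Gamma_gt0//.
rewrite mulrC ler_pdivrMr ?expR_gt0//.
exact: Gamma_le_stirling.
Qed.

(** The complement of the slab in the ball consists of two opposite caps, each of
    volume at most a quarter of that of the ball. *)
Lemma slab_ge (d : R) y : 0 <= d ->
  4 * (expR 1 * (b + 1)) <= expR (n%:R * d ^+ 2 / 2) ->
  ((V / 2)%:E <= leb (slab d y))%E.
Proof.
move=> d0 dn.
have [y0|y0] := eqVneq (enorm y) 0.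
  rewrite (_ : slab d y = ball); last first.
    apply/seteqP; split=> z; first by case=> /ballP.
    by move=> /ballP z1; split=> //; rewrite dot_enorm0// normr0 y0 mulr0.
  by rewrite lebesgue_unit_ball// lee_fin; have := V0; lra.
have {}y0 : 0 < enorm y by rewrite lt_def y0 enorm_ge0.
pose w : n.-tuple R := affine_tuple (-1) (@zero_tuple R n) y.
have wE : enorm w = enorm y.
  by rewrite /enorm /w dot_scaler dotC dot_scaler mulrA mulrNN !mul1r.
have mcap := measurable_cap d.
have lecap x : enorm x = enorm y -> (leb (cap d x) <= (V / 4)%:E)%E.
  move=> xy; have x0 : 0 < enorm x by rewrite xy.
  apply: le_trans (lebesgue_cap_le n0 x0 d0) _; rewrite lee_fin gauss_peakE expRN.
  rewrite ler_pdivrMr ?expR_gt0//; apply: le_trans ball_volume_ge _.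
  by have := ler_wpM2l (ltW V0) dn; lra.
have Bsub : ball `<=` slab d y `|` (cap d y `|` cap d w).
  move=> z /ballP z1.
  have [zy|zy] := leP `|dot z y| (d * enorm y); first by left.
  right; move: zy; rewrite lter_normr => /orP[zy|zy]; [left|right]; split=> //.
    exact: ltW.
  by rewrite wE dot_scaler mulN1r ltW.
have : (V%:E <= leb (slab d y) + ((V / 4)%:E + (V / 4)%:E))%E.
  rewrite -lebesgue_unit_ball//.
  apply: (@le_trans _ _ (leb (slab d y `|` (cap d y `|` cap d w)))).
    apply: le_measure => //; rewrite inE; first exact: measurable_ball.
    by apply: measurableU; [exact: measurable_slab|exact: measurableU].
  apply: le_trans (measureU2 _ _ _) _.
  - exact: measurable_slab.
  - exact: measurableU.
  apply: leeD => //; apply: le_trans (measureU2 _ _ _) _ => //.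
  by apply: leeD; exact: lecap.
rewrite -EFinD -leeBlDr// -EFinB; congr (_ <= _)%E; congr EFin; lra.
Qed.

Lemma laplace_ball_growth (t r d : R) y : 0 <= t -> 0 < r -> 0 <= d ->
  t ^+ 2 + 2 * t * r * d + r ^+ 2 <= 1 ->
  4 * (expR 1 * (b + 1)) <= expR (n%:R * d ^+ 2 / 2) ->
  ((r ^+ n * (V / 2) * expR ((t - r * d) * enorm y))%:E <= laplace_ball y)%E.
Proof.
move=> t0 r0 d0 tr1 dn; apply: le_trans (laplace_ball_slab y t0 r0 d0 tr1).
rewrite mulrAC EFinM; apply: lee_wpmul2l; last exact: slab_ge.
by rewrite lee_fin mulr_ge0 ?exprn_ge0 ?expR_ge0 ?ltW.
Qed.

(** Finiteness in each dimension: a very wide slab satisfies the volume condition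
    for every n, and a small enough r still gives exponential growth. *)
Lemma mahler1_ball_lty : (mahler1_body ball < +oo)%E.
Proof.
have bp := b0; have Vp := V0.
have e0 : 1 <= expR 1 :> R by rewrite -[leLHS]expR0 ler_expR.
pose d : R := 8 * (expR 1 * (b + 1)).
have eb : b <= expR 1 * (b + 1).
  by have := ler_wpM2r (ltW b0) e0; lra.
have eb1 : 1 <= expR 1 * (b + 1).
  by have := ler_wpM2r (ltW b0) e0; lra.
have d1 : 8 <= d by rewrite /d; lra.
have d0 : 0 < d by lra.
(* With t = 1 / 2 this makes r (1 + d) = 1 / 4, hence t - r d >= 1 / 4. *)
pose r : R := (4 * (1 + d))^-1.
have r0 : 0 < r by rewrite invr_gt0; lra.
have rE : r + r * d = 4^-1 by rewrite /r; field; rewrite gt_eqF//; lra.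
have L0 : 0 < r ^+ n * (V / 2) by rewrite mulr_gt0 ?exprn_gt0// divr_gt0.
have rd0 : 0 < r * d by rewrite mulr_gt0.
have c0 : 0 < 2^-1 - r * d by lra.
apply: le_lt_trans (mahler1_ball_le_of_growth n0 L0 c0 _) (ltry _) => y.
apply: laplace_ball_growth => //; [exact: ltW| |].
  have : r ^+ 2 <= 4^-1 ^+ 2 by rewrite lerXn2r ?nnegrE ?ltW//; lra.
  rewrite [2 * 2^-1]mulfV// mul1r; lra.
have h : n%:R * d ^+ 2 / 2 = b * d ^+ 2 by rewrite /b; ring.
rewrite h; apply: le_trans (expR_ge1Dx _).
have n1 : 1 <= n%:R :> R by rewrite ler1n.
have b2 : 2^-1 <= b by rewrite /b; lra.
have : 2^-1 * d ^+ 2 <= b * d ^+ 2 by rewrite ler_wpM2r ?sqr_ge0.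
have : 8 * d <= d ^+ 2 by rewrite expr2; apply: ler_wpM2r => //; exact: ltW.
rewrite /d; lra.
Qed.

(** Here t = r with 2 r^2 (1 + d) = 1, so that r tends to 1 / sqrt 2 as d tends
    to 0. *)
Lemma mahler1_ball_le (d : R) : 0 < d -> d < 1 ->
  4 * (expR 1 * (b + 1)) <= expR (n%:R * d ^+ 2 / 2) ->
  (mahler1_body ball <=
   (2 * V ^+ 2 * Gamma (n%:R + 1) * (2 * (1 + d) / (1 - d)) ^+ n)%:E)%E.
Proof.
move=> d0 d1 dn.
pose r : R := Num.sqrt (2 * (1 + d))^-1.
have q1 : 0 < 2 * (1 + d) by lra.
have q0 : 0 < (2 * (1 + d))^-1 by rewrite invr_gt0.
have r0 : 0 < r by rewrite sqrtr_gt0.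
have r2 : r ^+ 2 = (2 * (1 + d))^-1 by rewrite sqr_sqrtr// ltW.
have L0 : 0 < r ^+ n * (V / 2) by rewrite mulr_gt0 ?exprn_gt0// divr_gt0.
have c0 : 0 < r - r * d.
  by rewrite -{1}(mulr1 r) -mulrBr mulr_gt0// subr_gt0.
apply: le_trans (mahler1_ball_le_of_growth n0 L0 c0 _) _ => [y|].
  apply: laplace_ball_growth => //; [exact: ltW|exact: ltW|].
  rewrite (_ : _ + _ = r ^+ 2 * (2 * (1 + d))); last by ring.
  by rewrite r2 mulVf ?gt_eqF.
rewrite lee_fin le_eqVlt; apply/orP; left; apply/eqP.
have -> : 2 * (1 + d) / (1 - d) = (r * (r - r * d))^-1.
  rewrite (_ : r * (r - r * d) = r ^+ 2 * (1 - d)); last by ring.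
  by rewrite r2 invfM invrK.
rewrite exprVn [(r * (r - r * d)) ^+ n]exprMn.
have rn0 : r ^+ n != 0 by rewrite gt_eqF// exprn_gt0.
have cn0 : (r - r * d) ^+ n != 0 by rewrite gt_eqF// exprn_gt0.
move: (r ^+ n) ((r - r * d) ^+ n) rn0 cn0 => rn cn rn0 cn0.
by field; rewrite rn0 cn0 gt_eqF.
Qed.

End Slab.

(** * Bounds on the modified Bessel function *)
Section Bessel.
Variables (R : realType) (alpha x : R).
Hypotheses (alpha0 : 0 < alpha) (x0 : 0 < x).

Definition bessel_term (m : nat) : R :=
  (x / 2) `^ ((2 * m)%:R + alpha) / (m`!%:R * Gamma (m%:R + alpha + 1)).

Lemma bessel_term_gt0 m : 0 < bessel_term m.
Proof.
rewrite divr_gt0 ?powR_gt0 ?divr_gt0// mulr_gt0 ?ltr0n ?fact_gt0//.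
by rewrite Gamma_gt0// ltr_wpDl.
Qed.

Lemma nondecreasing_series_bessel : nondecreasing_seq (series bessel_term).
Proof.
apply/nondecreasing_seqP => m; rewrite seriesSr lerDl.
exact/ltW/bessel_term_gt0.
Qed.

Let A (l : R) := expR (alpha * ln (x / 2) + l - alpha * ln l).

(** Bounding 1 / Gamma(m + alpha + 1) by e^l l^(-m - alpha) leaves the exponential
    series. *)
Lemma bessel_term_le (l : R) m : 0 < l ->
  bessel_term m <= A l * exp_coeff (x ^+ 2 / (4 * l)) m.
Proof.
move=> l0; have m0 : 0 < m%:R + alpha by rewrite ltr_wpDl.
have x20 : 0 < x / 2 by rewrite divr_gt0.
have f0 : 0 < m`!%:R :> R by rewrite ltr0n fact_gt0.
rewrite /exp_coeff /= mulrA ler_pdivlMr//.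
rewrite /bessel_term invfM mulrCA -mulrA mulrCA mulVf ?gt_eqF// mulr1.
rewrite ler_pdivrMr ?Gamma_gt0//.
apply: le_trans (ler_wpM2l _ (Gamma_ge m0 l0)); last first.
  by rewrite mulr_ge0 ?expR_ge0// exprn_ge0// divr_ge0 ?sqr_ge0// mulr_ge0// ltW.
have -> : x ^+ 2 / (4 * l) = expR (2 * ln (x / 2) - ln l).
  rewrite expRB expRM_natl !lnK ?posrE//.
  by field; rewrite gt_eqF.
rewrite powR_expR// -expRM_natl -!expRD ler_expR natrM; lra.
Qed.

Lemma series_bessel_le (l : R) m : 0 < l ->
  series bessel_term m <= A l * expR (x ^+ 2 / (4 * l)).
Proof.
move=> l0; set q := x ^+ 2 / (4 * l).
have q0 : 0 <= q by rewrite divr_ge0 ?sqr_ge0// mulr_ge0// ltW.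
apply: (@le_trans _ _ (A l * series (exp_coeff q) m)).
  rewrite /series /= mulr_sumr; apply: ler_sum => i _; exact: bessel_term_le.
rewrite ler_wpM2l ?expR_ge0//; apply: nondecreasing_cvgn_le.
  by apply/nondecreasing_seqP => k; rewrite seriesSr lerDl exp_coeff_ge0.
exact: is_cvg_series_exp_coeff.
Qed.

Lemma is_cvg_series_bessel : cvgn (series bessel_term).
Proof.
apply: nondecreasing_is_cvgn nondecreasing_series_bessel _.
exists (A 1 * expR (x ^+ 2 / (4 * 1))) => _ [m _ <-].
exact: series_bessel_le.
Qed.

Lemma besselI_le (l : R) : 0 < l ->
  besselI alpha x <=
  expR (alpha * ln (x / 2) + l - alpha * ln l + x ^+ 2 / (4 * l)).
Proof.
move=> l0; rewrite expRD; apply: limr_le; first exact: is_cvg_series_bessel.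
by near=> m; exact: series_bessel_le.
Unshelve. all: by end_near. Qed.

Lemma besselI_ge_term m : bessel_term m <= besselI alpha x.
Proof.
apply: (@le_trans _ _ (series bessel_term m.+1)).
  rewrite seriesSr lerDr; apply: sumr_ge0 => i _; exact/ltW/bessel_term_gt0.
apply: nondecreasing_cvgn_le; first exact: nondecreasing_series_bessel.
exact: is_cvg_series_bessel.
Qed.

Lemma besselI_gt0 : 0 < besselI alpha x.
Proof. exact: lt_le_trans (bessel_term_gt0 0) (besselI_ge_term 0). Qed.

End Bessel.

(** * The Bessel integral *)
Section BesselIntegral.
Variables (R : realType) (n : nat).
Hypothesis n0 : (0 < n)%N.
Local Notation lam := (@lebesgue_measure R).
Let alpha : R := n%:R / 2.

Definition bessel_integrand (r : R) : R :=
  r `^ (3 * n%:R / 2 - 1) / besselI alpha r.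

Definition bessel_integral : \bar R :=
  (\int[lam]_(r in `]0%R, +oo[) (bessel_integrand r)%:E)%E.

(** (2 n^(3/2) / e^(3/2))^n; see [bessel_rateE]. *)
Definition bessel_rate : R :=
  expR (n%:R * ln 2 + 3 * alpha * ln n%:R - 3 * alpha).

Let nR : 0 < n%:R :> R. Proof. by rewrite ltr0n. Qed.
Let n1 : 1 <= n%:R :> R. Proof. by rewrite ler1n. Qed.
Let alpha0 : 0 < alpha. Proof. by rewrite divr_gt0. Qed.
Let nE : n%:R = 2 * alpha. Proof. by rewrite mulrC divfK. Qed.

Lemma bessel_integrand_ge0 r : 0 < r -> 0 <= bessel_integrand r.
Proof. by move=> r0; rewrite divr_ge0 ?powR_ge0// ltW// besselI_gt0. Qed.

(** The integrand is bounded below on [a, a + 1] with a = sqrt 2 * n, which is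
    written as an exponential so that its logarithm is explicit. *)
Lemma bessel_integral_ge :
  ((bessel_rate * (expR (- 3) / n%:R))%:E <= bessel_integral)%E.
Proof.
have n1' := n1; pose a : R := expR (ln 2 / 2 + ln n%:R).
have a0 : 0 < a by exact: expR_gt0.
have a2 : a ^+ 2 = 2 * n%:R ^+ 2.
  rewrite -expRM_natl (_ : _ * _ = ln 2 + ln n%:R + ln n%:R); last by lra.
  by rewrite !expRD !lnK ?posrE//; ring.
have a2n : a <= 2 * n%:R.
  rewrite -(@ler_pXn2r _ 2) ?nnegrE ?(ltW a0) ?mulr_ge0 ?(ltW nR)// a2 exprMn.
  by rewrite ler_wpM2r ?sqr_ge0//; lra.
have ln21 : ln 2 <= 1 :> R by have := @ln_le_subr1 R 2; lra.
have lna : ln a = ln 2 / 2 + ln n%:R by rewrite /a expRK.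
apply: (@le_trans _ _ (\int[lam]_(r in `[a, (a + 1)%R])
   (bessel_rate * (expR (- 3) / n%:R))%:E)%E).
  rewrite integral_cst//= lebesgue_measure_itv/= lte_fin ltrDl ltr01.
  by rewrite -EFinB addrAC subrr add0r mule1.
apply: (@le_trans _ _
    (\int[lam]_(r in `[a, (a + 1)%R]) (bessel_integrand r)%:E)%E); last first.
  apply: ge0_integral_mono_set => r /=; rewrite !in_itv/= ?andbT.
    by move=> r0; rewrite lee_fin bessel_integrand_ge0.
  by move=> /andP[ar _]; exact: lt_le_trans ar.
apply: ge0_integral_mono => r /=; rewrite in_itv/= => /andP[ar ra].
  by rewrite lee_fin mulr_ge0 ?expR_ge0// divr_ge0 ?expR_ge0.
have r0 : 0 < r by exact: lt_le_trans ar.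
rewrite lee_fin /bessel_integrand ler_pdivlMr ?besselI_gt0//.
apply: le_trans (ler_wpM2l _ (besselI_le alpha0 r0 nR)) _.
  by rewrite mulr_ge0 ?expR_ge0// divr_ge0 ?expR_ge0.
rewrite (_ : n%:R^-1 = expR (- ln n%:R)); last by rewrite expRN lnK.
rewrite powR_expR// -!expRD ler_expR.
have r2 : r ^+ 2 / (4 * n%:R) <= alpha + 2.
  rewrite ler_pdivrMr ?mulr_gt0//.
  have : r ^+ 2 <= (a + 1) ^+ 2 by apply: lerXn2r; rewrite ?nnegrE; lra.
  have -> : (a + 1) ^+ 2 = 2 * n%:R ^+ 2 + 2 * a + 1 by rewrite -a2; ring.
  rewrite (_ : (alpha + 2) * _ = 2 * n%:R ^+ 2 + 8 * n%:R); last first.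
    by rewrite /alpha; field.
  lra.
have lr : ln a <= ln r by rewrite ler_ln ?posrE.
have : (n%:R - 1) * ln a <= (n%:R - 1) * ln r by rewrite ler_wpM2l// subr_ge0.
rewrite lna ln_div ?posrE// /bessel_rate.
rewrite -/alpha in r2 *; rewrite !nE; move: r2; rewrite !nE => r2 h; lra.
Qed.

(** Bound on the integrand for r <= 1, from the first term of the series. *)
Let Csmall : R := Gamma (alpha + 1) * expR (alpha * ln 2).
(** The least index for which the term of the series beats r^(3n/2 - 1) by a
    factor of order at least r^2 at infinity. *)
Let m := n./2.+1.
Let Clarge : R :=
  m`!%:R * Gamma (m%:R + alpha + 1) * expR (((2 * m)%:R + alpha) * ln 2).

Let mE : exists2 e : R, 0 <= e <= 1 & m%:R = alpha + e.
Proof.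
exists (m%:R - alpha); last by rewrite subrKC.
have := odd_double_half n; rewrite /m => hn.
have : n%:R = (odd n)%:R + 2 * n./2%:R :> R by rewrite -{1}hn natrD -mul2n natrM.
rewrite nE -[n./2.+1]addn1 natrD; case: (odd n) => /= h; lra.
Qed.

Lemma bessel_integrand_le_small r : 0 < r -> r <= 1 ->
  bessel_integrand r <= Csmall.
Proof.
move=> r0 r1; rewrite /bessel_integrand ler_pdivrMr ?besselI_gt0//.
have C00 : 0 < Csmall by rewrite mulr_gt0 ?expR_gt0 ?Gamma_gt0.
apply: le_trans (ler_wpM2l (ltW C00) (besselI_ge_term alpha0 r0 0)).
rewrite /bessel_term muln0 fact0 mul1r /Csmall !add0r.
rewrite [leRHS](_ : _ = expR (alpha * ln 2) * (r / 2) `^ alpha); last first.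
  by field; rewrite gt_eqF// Gamma_gt0.
rewrite !powR_expR ?divr_gt0// -expRD ler_expR ln_div ?posrE//.
have lr : ln r <= 0 by rewrite ln_le0.
have n1' := n1; have : (n%:R - 1) * ln r <= 0.
  by rewrite mulr_ge0_le0// subr_ge0.
rewrite !nE; lra.
Qed.

Lemma bessel_integrand_le_large r : 1 <= r ->
  bessel_integrand r <= Clarge / r ^+ 2.
Proof.
move=> r1; have r0 : 0 < r by lra.
rewrite /bessel_integrand ler_pdivrMr ?besselI_gt0//.
have m0 : 0 < m%:R + alpha by rewrite ltr_wpDl.
have f0 : 0 < m`!%:R :> R by rewrite ltr0n fact_gt0.
have G0 := Gamma_gt0 m0.
have C10 : 0 < Clarge / r ^+ 2.
  by rewrite divr_gt0 ?exprn_gt0// !mulr_gt0 ?expR_gt0.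
apply: le_trans (ler_wpM2l (ltW C10) (besselI_ge_term alpha0 r0 m)).
rewrite /bessel_term /Clarge.
rewrite [leRHS](_ : _ = expR (((2 * m)%:R + alpha) * ln 2) *
  ((r / 2) `^ ((2 * m)%:R + alpha) * (r ^+ 2)^-1)); last first.
  by field; rewrite !gt_eqF.
have -> : (r ^+ 2)^-1 = expR (- (2 * ln r)).
  by rewrite expRN expRM_natl lnK ?posrE.
rewrite !powR_expR ?divr_gt0// -!expRD ler_expR ln_div ?posrE//.
have lr : 0 <= ln r by rewrite ln_ge0.
have [e /andP[e0 e1] me] := mE.
have n2m : n%:R + 1 <= (2 * m)%:R :> R.
  rewrite natr1 ler_nat /m -[X in (X < _)%N](odd_double_half n) -mul2n.
  by case: (odd n); rewrite mulnS.
have : (n%:R + 1) * ln r <= (2 * m)%:R * ln r by rewrite ler_wpM2r.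
rewrite !nE; lra.
Qed.

Let Csmall_gt0 : 0 < Csmall.
Proof. by rewrite mulr_gt0 ?expR_gt0 ?Gamma_gt0. Qed.

Let Clarge_gt0 : 0 < Clarge.
Proof.
rewrite mulr_gt0 ?expR_gt0// mulr_gt0 ?ltr0n ?fact_gt0//.
by rewrite Gamma_gt0// ltr_wpDl.
Qed.

(** Both bounds are dominated by a multiple of 1 / (1 + r^2). *)
Lemma bessel_integral_le_constants :
  (bessel_integral <= (pi * (Csmall + Clarge))%:E)%E.
Proof.
have C00 := Csmall_gt0; have C10 := Clarge_gt0.
have C20 : 0 < 2 * (Csmall + Clarge) by rewrite mulr_gt0// addr_gt0.
rewrite (_ : pi * _ = 2 * (Csmall + Clarge) * (pi / 2)); last by field.
rewrite EFinM -integral0y_oneDsqr -ge0_integralZl//; first last.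
- by rewrite lee_fin ltW.
- apply/measurable_EFinP/measurable_funTS; apply: continuous_measurable_fun.
  exact: continuous_oneDsqrV.
rewrite -integral_itv_obnd_cbnd//; last first.
  apply: emeasurable_funM => //.
  apply/measurable_EFinP/measurable_funTS; apply: continuous_measurable_fun.
  exact: continuous_oneDsqrV.
apply: ge0_integral_mono => r /=; rewrite in_itv/= andbT => r0.
  by rewrite lee_fin bessel_integrand_ge0.
rewrite -EFinM lee_fin /oneDsqr.
have r20 : 0 < 1 + r ^+ 2 by rewrite ltr_wpDr ?sqr_ge0.
have [r1|r1] := leP r 1.
  apply: le_trans (bessel_integrand_le_small r0 r1) _.
  rewrite ler_pdivlMr//.
  have : r ^+ 2 <= 1 ^+ 2 by apply: lerXn2r; rewrite ?nnegrE; lra.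
  move=> /(ler_wpM2l (ltW C00)); lra.
apply: le_trans (bessel_integrand_le_large (ltW r1)) _.
rewrite ler_pdivlMr// mulrAC ler_pdivrMr ?exprn_gt0//.
have : 1 ^+ 2 <= r ^+ 2 by apply: lerXn2r; rewrite ?nnegrE; lra.
move=> /(ler_wpM2l (ltW C10)) h.
have := mulr_ge0 (ltW C00) (sqr_ge0 r); lra.
Qed.

Let ln_alpha : ln alpha = ln n%:R - ln 2.
Proof. by rewrite ln_div ?posrE. Qed.

(** The factor e^e absorbs n (1 - ln (2 n)), which is bounded above. *)
Lemma Csmall_le :
  Csmall <= expR 1 * expR (expR 1) * (n%:R + 2) ^+ 4 * bessel_rate.
Proof.
have an : alpha + 1 <= (n%:R + 2) ^+ 4.
  have N1 : 1 <= (n%:R + 2 : R) by have := n1; lra.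
  apply: (@le_trans _ _ (n%:R + 2)); first by rewrite nE; have := alpha0; lra.
  by rewrite -{1}[n%:R + 2]expr1; exact: ler_weXn2l.
rewrite /Csmall; apply: (@le_trans _ _
    (expR 1 * (alpha + 1) * stirling alpha * expR (alpha * ln 2))).
  by rewrite ler_wpM2r ?expR_ge0//; exact: Gamma_le_stirling.
have h : stirling alpha * expR (alpha * ln 2) <= expR (expR 1) * bessel_rate.
  rewrite -!expRD ler_expR ln_alpha.
  have : ln (expR 1 / (2 * n%:R)) <= expR 1 / (2 * n%:R) - 1 :> R.
    by apply: ln_le_subr1; rewrite divr_gt0 ?mulr_gt0 ?expR_gt0.
  rewrite ln_div ?posrE ?mulr_gt0 ?expR_gt0// expRK lnM ?posrE// => h.
  have := ler_wpM2l (ltW nR) h.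
  rewrite (_ : n%:R * (expR 1 / (2 * n%:R) - 1) = expR 1 / 2 - n%:R); last first.
    by field; rewrite gt_eqF.
  have := expR_ge0 (1 : R); have := nR; rewrite !nE; lra.
rewrite -mulrA -[leRHS]mulrA [leRHS](_ : _ =
  expR 1 * (n%:R + 2) ^+ 4 * (expR (expR 1) * bessel_rate)); last by ring.
apply: ler_pM => //; rewrite ?mulr_ge0 ?expR_ge0//.
  by rewrite addr_ge0// ltW.
by rewrite ler_pM2l ?expR_gt0.
Qed.

Lemma Clarge_le : Clarge <= 4 * expR 1 ^+ 2 * (n%:R + 2) ^+ 4 * bessel_rate.
Proof.
have [e /andP[e0 e1] me] := mE; have a0 := alpha0.
have ma : m%:R + alpha = n%:R + e by rewrite me nE; lra.
have f1 : m`!%:R <= expR 1 * (n%:R + 2) * ((n%:R + 2) * stirling alpha).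
  apply: le_trans (fact_le_stirling _ _) _ => //.
  apply: ler_pM; rewrite ?mulr_ge0 ?expR_ge0//.
    by rewrite ler_pM2l ?expR_gt0// me nE; lra.
  rewrite me; apply: le_trans (stirling_shift a0 _) _; first by rewrite e0.
  by rewrite ler_wpM2r ?expR_ge0// nE; lra.
have f2 : Gamma (m%:R + alpha + 1) <=
    expR 1 * (n%:R + 2) * ((n%:R + 2) * stirling n%:R).
  apply: le_trans (Gamma_le_stirling _) _; first by rewrite ltr_wpDl.
  rewrite ma; apply: ler_pM; rewrite ?mulr_ge0 ?expR_ge0//.
  - by rewrite !addr_ge0.
  - by rewrite ler_pM2l ?expR_gt0//; lra.
  apply: le_trans (stirling_shift nR _) _; first by rewrite e0.
  by rewrite ler_wpM2r ?expR_ge0//; lra.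
have f3 : expR (((2 * m)%:R + alpha) * ln 2) <= 4 * expR (3 * alpha * ln 2).
  have -> : 4 = expR (2 * ln 2) :> R by rewrite expRM_natl lnK ?posrE//; ring.
  rewrite -expRD ler_expR natrM me -mulrDl.
  by rewrite ler_wpM2r ?ln_ge0 ?ler1n//; lra.
rewrite /Clarge; apply: (@le_trans _ _
    (expR 1 * (n%:R + 2) * ((n%:R + 2) * stirling alpha) *
     (expR 1 * (n%:R + 2) * ((n%:R + 2) * stirling n%:R)) *
     (4 * expR (3 * alpha * ln 2)))).
  have g0 : 0 <= Gamma (m%:R + alpha + 1) by rewrite ltW// Gamma_gt0// ltr_wpDl.
  by apply: ler_pM => //; rewrite ?mulr_ge0 ?expR_ge0//; apply: ler_pM.
have -> : bessel_rate = stirling alpha * stirling n%:R * expR (3 * alpha * ln 2).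
  by rewrite -!expRD ln_alpha /bessel_rate !nE; congr expR; ring.
by rewrite le_eqVlt; apply/orP; left; apply/eqP; ring.
Qed.

Lemma bessel_integral_le : (bessel_integral <=
  (bessel_rate *
   (pi * (expR 1 * expR (expR 1) + 4 * expR 1 ^+ 2) * (n%:R + 2) ^+ 4))%:E)%E.
Proof.
apply: le_trans bessel_integral_le_constants _; rewrite lee_fin.
rewrite [leRHS](_ : _ = pi *
  (expR 1 * expR (expR 1) * (n%:R + 2) ^+ 4 * bessel_rate
  + 4 * expR 1 ^+ 2 * (n%:R + 2) ^+ 4 * bessel_rate)); last by ring.
rewrite ler_pM2l ?pi_gt0//; apply: lerD; [exact: Csmall_le|exact: Clarge_le].
Qed.

End BesselIntegral.

(** * Comparison up to e^o(n) *)
Section Expo.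
Variable R : realType.

Lemma poly_le_expR (K e : R) (D : nat) : 0 <= K -> 0 < e ->
  \forall n \near \oo, K * (n%:R + 2) ^+ D <= expR (e * n%:R).
Proof.
move=> K0 e0.
pose M : R := K * 3 ^+ D * D.+1`!%:R / e ^+ D.+1.
near=> n.
have n1 : 1 <= n%:R :> R by rewrite ler1n; near: n; exact: nbhs_infty_gt.
have nM : M <= n%:R by near: n; exact: nbhs_infty_ger.
have en0 : 0 <= e * n%:R by rewrite mulr_ge0// ltW.
apply: le_trans (expR_ge1Dxn D en0).
apply: (@le_trans _ _ ((e * n%:R) ^+ D.+1 / D.+1`!%:R)); last by rewrite lerDr.
have f0 : 0 < D.+1`!%:R :> R by rewrite ltr0n fact_gt0.
rewrite ler_pdivlMr// exprMn.
apply: (@le_trans _ _ (e ^+ D.+1 * (M * n%:R ^+ D))); last first.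
  rewrite ler_pM2l ?exprn_gt0// [n%:R ^+ D.+1]exprS.
  by rewrite ler_wpM2r ?exprn_ge0.
have -> : e ^+ D.+1 * (M * n%:R ^+ D) = K * (3 * n%:R) ^+ D * D.+1`!%:R.
  by rewrite /M exprMn; field; rewrite expf_neq0// gt_eqF.
rewrite ler_wpM2r ?ler_wpM2l// lerXn2r ?nnegrE//; lra.
Unshelve. all: by end_near. Qed.

(** In logarithms the two bounds say |ln (a_n / b_n)| <= e n. *)
Lemma eq_up_to_expo_squeeze (a : nat -> \bar R) (b : nat -> R) :
  (forall n, (0 < n)%N -> 0 < b n) ->
  (forall n, (0 < n)%N -> (0 < a n < +oo)%E) ->
  (forall e, 0 < e -> \forall n \near \oo,
     ((b n * expR (- (e * n%:R)))%:E <= a n <= (b n * expR (e * n%:R))%:E)%E) ->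
  eq_up_to_expo a (fun n => (b n)%:E).
Proof.
move=> b0 a0 ab; exists (fun n => fine (a n) / b n).
have aE n : (0 < n)%N -> exists2 r, 0 < r & a n = r%:E.
  move=> /a0; case: (a n) => [r| |] /andP[r0 ry] //.
  by exists r.
split.
- by move=> n n0; have [r r0 ->] := aE n n0; rewrite divr_gt0// b0.
- apply/cvgrPdist_le => e e0; near=> n.
  have n0 : (0 < n)%N by near: n; exact: nbhs_infty_gt.
  have nR : 0 < n%:R :> R by rewrite ltr0n.
  have : ((b n * expR (- (e * n%:R)))%:E <= a n <= (b n * expR (e * n%:R))%:E)%E.
    by near: n; exact: ab.
  have bn := b0 n n0.
  have [r r0 ->] := aE n n0; rewrite /= !lee_fin => /andP[lo hi].
  have q0 : 0 < r / b n by rewrite divr_gt0.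
  rewrite sub0r normrN normrM gtr0_norm ?invr_gt0// ler_pdivrMl//.
  rewrite ler_norml; apply/andP; split.
    rewrite -(expRK (- _)) ler_ln ?posrE ?expR_gt0// ler_pdivlMr//.
    by rewrite mulrC [n%:R * e]mulrC.
  rewrite -[leRHS]expRK ler_ln ?posrE ?expR_gt0// ler_pdivrMr//.
  by rewrite mulrC [n%:R * e]mulrC.
- move=> n n0; have [r r0 ->] := aE n n0; rewrite -EFinM /=.
  by congr EFin; rewrite mulrC divfK// gt_eqF// b0.
Unshelve. all: by end_near. Qed.

End Expo.

(** * Asymptotics *)
Section Final.
Variable R : realType.

Lemma bessel_rateE n : (0 < n)%N ->
  (2 * n%:R `^ (3 / 2) / expR (3 / 2)) ^+ n = bessel_rate R n.
Proof.
move=> n0; have nR : 0 < n%:R :> R by rewrite ltr0n.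
rewrite powR_expR// /bessel_rate.
rewrite [RHS](_ : _ = expR (n%:R * (ln 2 + 3 / 2 * ln n%:R - 3 / 2))); last first.
  by congr expR; field.
by rewrite expRM_natl expRB expRD lnK ?posrE.
Qed.

Lemma bessel_asymptotics :
  @eq_up_to_expo R (fun n => bessel_integral R n)
    (fun n => ((2 * n%:R `^ (3 / 2) / expR (3 / 2)) ^+ n)%:E).
Proof.
have rate0 n : 0 < bessel_rate R n by exact: expR_gt0.
apply: eq_up_to_expo_squeeze.
- by move=> n n0; rewrite bessel_rateE.
- move=> n n0; have nR : 0 < n%:R :> R by rewrite ltr0n.
  rewrite (lt_le_trans _ (bessel_integral_ge R n0)) ?lte_fin; last first.
    by rewrite mulr_gt0// divr_gt0// expR_gt0.
  exact: le_lt_trans (bessel_integral_le R n0) (ltry _).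
move=> e e0; near=> n.
have n0 : (0 < n)%N by near: n; exact: nbhs_infty_gt.
have nR : 0 < n%:R :> R by rewrite ltr0n.
rewrite bessel_rateE//; apply/andP; split.
  apply: le_trans (bessel_integral_ge R n0); rewrite lee_fin ler_pM2l//.
  rewrite !expRN -invfM lef_pV2 ?posrE ?mulr_gt0 ?expR_gt0//.
  apply: (@le_trans _ _ (expR 3 * (n%:R + 2) ^+ 1)).
    by rewrite expr1 ler_pM2l ?expR_gt0// lerDl.
  by near: n; apply: poly_le_expR => //; exact: expR_ge0.
apply: le_trans (bessel_integral_le R n0) _; rewrite lee_fin ler_pM2l//.
near: n; apply: poly_le_expR => //.
by rewrite mulr_ge0 ?pi_ge0// addr_ge0 ?mulr_ge0 ?exprn_ge0 ?expR_ge0.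
Unshelve. all: by end_near. Qed.

Lemma stirling_half n : (0 < n)%N ->
  stirling (n%:R / 2 : R) ^+ 2 = expR (n%:R * ln n%:R - n%:R * ln 2 - n%:R).
Proof.
move=> n0; rewrite -expRM_natl ln_div ?posrE ?ltr0n//.
by congr expR; field.
Qed.

Lemma mahler1_ball_lower n : (0 < n)%N ->
  (((4 * pi) ^+ n / (expR 1 * (n%:R / 2 + 1)) ^+ 2)%:E <=
   mahler1_body (@unit_ball R n))%E.
Proof.
move=> n0; have nR : 0 < n%:R :> R by rewrite ltr0n.
have b0 : 0 < n%:R / 2 :> R by rewrite divr_gt0.
apply: le_trans (mahler1_ball_ge R n0); rewrite lee_fin.
have c0 : 0 < expR 1 * (n%:R / 2 + 1) :> R by rewrite mulr_gt0 ?expR_gt0// addr_gt0.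
rewrite ler_pdivrMr ?exprn_gt0//.
have sp0 : 0 <= Num.sqrt pi ^+ n / stirling (n%:R / 2) :> R.
  by rewrite divr_ge0 ?exprn_ge0 ?expR_ge0.
have V0 := ball_volume_gt0 R n0.
have : (Num.sqrt pi ^+ n / stirling (n%:R / 2)) ^+ 2 <=
    (expR 1 * (n%:R / 2 + 1) * ball_volume R n) ^+ 2.
  apply: lerXn2r; rewrite ?nnegrE//; last exact: ball_volume_ge.
  by rewrite mulr_ge0 ?(ltW c0) ?(ltW V0).
rewrite expr_div_n -exprM mulnC exprM sqr_sqrtr ?pi_ge0// stirling_half//.
rewrite exprMn -expRN.
have E0 : 0 <= expR (- n%:R) * (2 * n%:R) ^+ n :> R.
  by rewrite mulr_ge0 ?expR_ge0// exprn_ge0// mulr_ge0// ltW.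
move=> /(ler_wpM2r E0) h.
apply: le_trans (le_trans _ h) _; rewrite le_eqVlt; apply/orP; left; apply/eqP.
  rewrite (_ : (2 * n%:R) ^+ n = expR (n%:R * (ln 2 + ln n%:R))); last first.
    by rewrite expRM_natl expRD !lnK ?posrE.
  rewrite (_ : (4 * pi) ^+ n = pi ^+ n * expR (n%:R * (2 * ln 2))); last first.
    rewrite expRM_natl expRM_natl lnK ?posrE// mulrC exprMn; congr (_ * _ ^+ n).
    by ring.
  by rewrite -mulrA -!expRD; congr (_ * expR _); ring.
by ring.
Qed.

(** The quotient (1 + d) / (1 - d) is at most e^(3 d) for d <= 1/2. *)
Lemma mahler1_ball_upper n (d : R) : (0 < n)%N -> 0 < d -> d <= 2^-1 ->
  4 * (expR 1 * (n%:R / 2 + 1)) <= expR (n%:R * d ^+ 2 / 2) ->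
  (mahler1_body (@unit_ball R n) <=
   ((4 * pi) ^+ n * (2 * expR 1 * (n%:R + 1)) * expR (3 * d * n%:R))%:E)%E.
Proof.
move=> n0 d0 d1 dn; have nR : 0 < n%:R :> R by rewrite ltr0n.
have b0 : 0 < n%:R / 2 :> R by rewrite divr_gt0.
have d11 : 0 < 1 - d by lra.
apply: le_trans (mahler1_ball_le n0 d0 _ dn) _; first lra.
rewrite lee_fin; have V0 := ball_volume_gt0 R n0.
have hV : ball_volume R n ^+ 2 <=
    pi ^+ n * expR (- (n%:R * ln n%:R - n%:R * ln 2 - n%:R)).
  have -> : pi ^+ n * expR (- (n%:R * ln n%:R - n%:R * ln 2 - n%:R)) =
      (Num.sqrt pi ^+ n / stirling (n%:R / 2)) ^+ 2 :> R.
    rewrite expr_div_n -exprM mulnC exprM sqr_sqrtr ?pi_ge0//.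
    by rewrite stirling_half// expRN.
  apply: lerXn2r; rewrite ?nnegrE ?(ltW V0)//; last exact: ball_volume_le.
  by rewrite divr_ge0 ?exprn_ge0 ?expR_ge0.
have hG := Gamma_le_stirling nR.
have hd : (2 * (1 + d) / (1 - d)) ^+ n <=
    expR (n%:R * ln 2) * expR (3 * d * n%:R).
  rewrite expRM_natl lnK ?posrE// expRM_natr -exprMn; apply: lerXn2r.
  - by rewrite nnegrE divr_ge0 ?mulr_ge0//; lra.
  - by rewrite nnegrE mulr_ge0 ?expR_ge0.
  rewrite -mulrA ler_pM2l//.
  have -> : 3 * d = d + 2 * d by ring.
  rewrite expRD; apply: ler_pM; rewrite ?invr_ge0; try lra.
    exact: expR_ge1Dx.
  apply: le_trans (expR_ge1Dx _); rewrite -[leLHS]mul1r ler_pdivrMr//; nra.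
have pn0 : 0 <= pi ^+ n :> R by rewrite exprn_ge0// pi_ge0.
rewrite -[leLHS]mulrA -mulrA.
apply: (@le_trans _ _ (2 *
  ((pi ^+ n * expR (- (n%:R * ln n%:R - n%:R * ln 2 - n%:R))) *
   (expR 1 * (n%:R + 1) * stirling n%:R *
    (expR (n%:R * ln 2) * expR (3 * d * n%:R)))))).
  rewrite ler_pM2l//; apply: ler_pM; rewrite ?sqr_ge0//.
    rewrite mulr_ge0 ?exprn_ge0 ?divr_ge0 ?mulr_ge0//; try lra.
    by rewrite ltW// Gamma_gt0.
  apply: ler_pM => //; first by rewrite ltW// Gamma_gt0.
  by rewrite exprn_ge0// divr_ge0 ?mulr_ge0//; lra.
rewrite (_ : (4 * pi) ^+ n = pi ^+ n * expR (n%:R * (2 * ln 2))); last first.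
  rewrite expRM_natl expRM_natl lnK ?posrE// mulrC exprMn; congr (_ * _ ^+ n).
  by ring.
rewrite le_eqVlt; apply/orP; left; apply/eqP.
have -> : expR (n%:R * (2 * ln 2)) =
    expR (- (n%:R * ln n%:R - n%:R * ln 2 - n%:R)) * stirling n%:R *
    expR (n%:R * ln 2) :> R.
  by rewrite -!expRD; congr expR; ring.
by ring.
Qed.

Lemma mahler1_ball_asymptotics :
  @eq_up_to_expo R (fun n => mahler1_body (@unit_ball R n))
    (fun n => ((4 * pi) ^+ n)%:E).
Proof.
have p0 n : 0 < (4 * pi) ^+ n :> R by rewrite exprn_gt0// mulr_gt0// pi_gt0.
apply: eq_up_to_expo_squeeze => //.
- move=> n n0; apply/andP; split; last exact: mahler1_ball_lty.
  apply: lt_le_trans (mahler1_ball_lower n0); rewrite lte_fin.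
  by rewrite divr_gt0// exprn_gt0// mulr_gt0 ?expR_gt0// addr_gt0// divr_gt0//
    ltr0n.
move=> e e0.
pose d : R := Num.min (e / 6) 2^-1.
have d0 : 0 < d by rewrite lt_min; apply/andP; split; lra.
have de : d <= e / 6 by rewrite ge_min lexx.
have d2 : d <= 2^-1 by rewrite ge_min lexx orbT.
near=> n.
have n0 : (0 < n)%N by near: n; exact: nbhs_infty_gt.
have nR : 0 < n%:R :> R by rewrite ltr0n.
apply/andP; split.
  apply: le_trans (mahler1_ball_lower n0); rewrite lee_fin ler_pM2l// expRN.
  have b0 : 0 < expR 1 * (n%:R / 2 + 1) :> R.
    by rewrite mulr_gt0 ?expR_gt0// addr_gt0// divr_gt0.
  rewrite lef_pV2 ?posrE ?expR_gt0 ?exprn_gt0//.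
  apply: (@le_trans _ _ (expR 1 ^+ 2 * (n%:R + 2) ^+ 2)).
    rewrite -exprMn; apply: lerXn2r.
    - by rewrite nnegrE ltW.
    - by rewrite nnegrE mulr_ge0 ?expR_ge0//; lra.
    - by rewrite ler_pM2l ?expR_gt0//; lra.
  by near: n; apply: poly_le_expR => //; rewrite exprn_ge0// expR_ge0.
apply: le_trans (mahler1_ball_upper n0 d0 d2 _) _.
  apply: (@le_trans _ _ (4 * expR 1 * (n%:R + 2) ^+ 1)).
    by rewrite expr1 mulrA ler_pM2l ?mulr_gt0 ?expR_gt0//; lra.
  rewrite (_ : n%:R * d ^+ 2 / 2 = d ^+ 2 / 2 * n%:R); last by ring.
  near: n; apply: poly_le_expR; first by rewrite mulr_ge0 ?expR_ge0.
  by rewrite divr_gt0 ?exprn_gt0.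
rewrite lee_fin -mulrA ler_pM2l//.
have -> : e * n%:R = e / 2 * n%:R + 3 * (e / 6) * n%:R by field.
rewrite expRD; apply: ler_pM; rewrite ?expR_ge0//.
- apply: (@le_trans _ _ (2 * expR 1 * (n%:R + 2) ^+ 1)).
    by rewrite expr1 ler_pM2l ?mulr_gt0 ?expR_gt0//; lra.
  near: n; apply: poly_le_expR; first by rewrite mulr_ge0 ?expR_ge0.
  by rewrite divr_gt0.
by rewrite ler_expR ler_pM2r//; lra.
Unshelve. all: by end_near. Qed.

End Final.

Theorem mainTheorem6 (R : realType) :
  [/\ @eq_up_to_expo R (fun n : nat => mahler1_body (@unit_ball R n))
                       (fun n : nat => mahler1_fun (@q2 R n)),
      @eq_up_to_expo R (fun n : nat => mahler1_body (@unit_ball R n))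
                       (fun n : nat => ((4 * pi) ^+ n)%:E)
    & @eq_up_to_expo R
        (fun n : nat => (\int[lebesgue_measure]_(r in `]0%R, +oo[)
           (r `^ (3 * n%:R / 2 - 1) / besselI (n%:R / 2) r)%:E)%E)
        (fun n : nat => ((2 * n%:R `^ (3 / 2) / expR (3 / 2)) ^+ n)%:E)].
Proof.
split; last exact: bessel_asymptotics.
  have -> : (fun n => mahler1_fun (@q2 R n)) =
      (fun n => ((4 * pi) ^+ n)%:E) by apply/funext => n; exact: mahler1_q2.
  exact: mahler1_ball_asymptotics.
exact: mahler1_ball_asymptotics.
Qed.
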